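(* Let $\mathfrak g$ be a Lie algebra over a field $k$ of characteristic zero and let $F:\mathcal Rep(\mathfrak g)\to\mathrm{Vect}$ be the forgetful functor. Then the $1$-bracket on $H^*(F)=\Lambda^*\mathfrak g$ coincides with the Schouten bracket $$\{x_1\wedge\dots\wedge x_s,\,y_1\wedge\dots\wedge y_t\}=\sum_{i,j}(-1)^{i+j}[x_i,y_j]\wedge x_1\wedge\dots\wedge\widehat{x_i}\wedge\dots\wedge x_s\wedge y_1\wedge\dots\wedge\widehat{y_j}\wedge\dots\wedge y_t ,$$ where $\widehat{z}$ means that $z$ does not occur in the product.
   Context: $\mathcal Rep(\mathfrak g)$ is the tensor category of modules over the universal enveloping algebra $U(\mathfrak g)$, with coproduct $\Delta$. $H^*(F)$ is the deformation cohomology of the tensor functor $F$: the cohomology of the complex $End(F^{\otimes n})$, $F^{\otimes n}(X_1,\dots,X_n)=F(X_1\otimes\cdots\otimes X_n)$, with differential the alternating sum of $\partial_0(a)=1\otimes a$, $\partial_i(a)=a_{X_1,\dots,X_i\otimes X_{i+1},\dots,X_{n+1}}$ ($1\le i\le n$), $\partial_{n+1}(a)=a\otimes 1$. Evaluating on the regular module identifies $End(F^{\otimes n})=U(\mathfrak g)^{\otimes n}$ with $\partial(a)=1\otimes a+\sum_{i=1}^n(-1)^i(id^{\otimes i-1}\otimes\Delta\otimes id^{\otimes n-i})(a)+(-1)^{n+1}a\otimes1$. The identification $\Lambda^*\mathfrak g\cong H^*(F)$ (an isomorphism in characteristic zero) is induced by $\mathfrak g=H^1(F)$ and the product $a\cup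 b=a\otimes b$, i.e. $x_1\wedge\dots\wedge x_n\mapsto[x_1\otimes\dots\otimes x_n]$. The $1$-bracket $H^m(F)\otimes H^n(F)\to H^{m+n-1}(F)$ is the one induced by $\{a,b\}=a\circ b-(-1)^{(n-1)(m-1)}b\circ a$ for $a\in U(\mathfrak g)^{\otimes m}$, $b\in U(\mathfrak g)^{\otimes n}$, where $a\circ b=\sum_{i=1}^m(-1)^{(n-1)i}a\circ_ib$ and $a\circ_ib=(id^{\otimes i-1}\otimes\Delta^{(n-1)}\otimes id^{\otimes m-i})(a)\cdot(1^{\otimes i-1}\otimes b\otimes1^{\otimes m-i})$ with $\Delta^{(n-1)}:U(\mathfrak g)\to U(\mathfrak g)^{\otimes n}$ the iterated coproduct.
   Formalization: The sign in a∘b is corrected from (-1)^{(n-1)i} to (-1)^{(n-1)(m-i)}; with the printed sign {x1⊗x2, y} is not a cocycle in general, so no bracket is induced on cohomology for m, n of different parity; for equal parity both signs give the same {a,b}. *)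

(* Defs.v *)
From HB Require Import structures.
From mathcomp Require Import all_boot all_order all_algebra.
From mathcomp Require Import boolp.

Set Implicit Arguments.
Unset Strict Implicit.
Unset Printing Implicit Defensive.

Import GRing.Theory.
Local Open Scope ring_scope.
Local Open Scope quotient_scope.

HB.mixin Record Lmodule_isLieAlgebra (k : fieldType) g of GRing.Lmodule k g := {
  lie : g -> g -> g;
  lie_linl : forall c x y z, lie (c *: x + y) z = c *: lie x z + lie y z;
  lie_linr : forall c x y z, lie z (c *: x + y) = c *: lie z x + lie z y;
  liexx : forall x, lie x x = 0;
  lie_jacobi : forall x y z,
    lie x (lie y z) + lie y (lie z x) + lie z (lie x y) = 0
}.

#[short(type="lieAlgType")]
HB.structure Definition LieAlgebra (k : fieldType) :=
  {g of GRing.Lmodule k g & Lmodule_isLieAlgebra k g}.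

Section MultilinearQuotient.
Variables (k : fieldType) (V : lmodType k).

Inductive mterm : Type :=
| MGen of seq V
| MZero
| MAdd of mterm & mterm
| MScale of k & mterm.

HB.instance Definition _ := gen_eqMixin mterm.
HB.instance Definition _ := gen_choiceMixin mterm.

Variable P : pred (seq V).

Inductive mcongr : mterm -> mterm -> Prop :=
| mc_refl a : mcongr a a
| mc_sym a b : mcongr a b -> mcongr b a
| mc_trans b a c : mcongr a b -> mcongr b c -> mcongr a c
| mc_add a a' b b' : mcongr a a' -> mcongr b b' ->
    mcongr (MAdd a b) (MAdd a' b')
| mc_scale c a a' : mcongr a a' -> mcongr (MScale c a) (MScale c a')
| mc_addA a b c : mcongr (MAdd a (MAdd b c)) (MAdd (MAdd a b) c)
| mc_addC a b : mcongr (MAdd a b) (MAdd b a)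
| mc_add0 a : mcongr (MAdd MZero a) a
| mc_scaleA c d a : mcongr (MScale c (MScale d a)) (MScale (c * d) a)
| mc_scale0 a : mcongr (MScale 0 a) MZero
| mc_scale1 a : mcongr (MScale 1 a) a
| mc_scaleDr c a b :
    mcongr (MScale c (MAdd a b)) (MAdd (MScale c a) (MScale c b))
| mc_scaleDl c d a :
    mcongr (MScale (c + d) a) (MAdd (MScale c a) (MScale d a))
| mc_lin c s x y t :
    mcongr (MGen (s ++ (c *: x + y) :: t))
           (MAdd (MScale c (MGen (s ++ x :: t))) (MGen (s ++ y :: t)))
| mc_null s : P s -> mcongr (MGen s) MZero.

Definition mrel a b := `[< mcongr a b >].

Lemma mrel_is_equiv : equiv_class_of mrel.
Proof.
split=> [a|a b|b a c]; first by apply/asboolP/mc_refl.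
  by apply/asboolP/asboolP; exact: mc_sym.
by move=> /asboolP ab /asboolP bc; apply/asboolP/(mc_trans ab bc).
Qed.

Canonical mrel_equiv := EquivRelPack mrel_is_equiv.
Canonical mrel_encModRel := defaultEncModRel mrel.

(* The k-module generated by symbols [s], s a finite sequence in V, subject to
   multilinearity in the entries of s and to [s] = 0 whenever P s. *)
Definition mquot := {eq_quot mrel}.
HB.instance Definition _ := Choice.on mquot.
HB.instance Definition _ := EqQuotient.on mquot.

Lemma mquot_eqP a b : mcongr a b <-> \pi_mquot a = \pi_mquot b.
Proof.
by split=> [ab|/eqquotP/asboolP//]; apply/eqquotP/asboolP.
Qed.

Definition mgen s : mquot := \pi_mquot (MGen s).
Definition mzero : mquot := \pi_mquot MZero.
Definition madd (u v : mquot) : mquot := \pi_mquot (MAdd (repr u) (repr v)).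
Definition mscale c (u : mquot) : mquot := \pi_mquot (MScale c (repr u)).

Lemma mrepr a : mcongr (repr (\pi_mquot a)) a.
Proof. by apply/mquot_eqP; rewrite reprK. Qed.

Lemma madd_pi a b : madd (\pi_mquot a) (\pi_mquot b) = \pi_mquot (MAdd a b).
Proof. by apply/mquot_eqP; apply: mc_add; apply: mrepr. Qed.

Lemma mscale_pi c a : mscale c (\pi_mquot a) = \pi_mquot (MScale c a).
Proof. by apply/mquot_eqP; apply: mc_scale; apply: mrepr. Qed.

Lemma maddA : associative madd.
Proof.
move=> u v w; rewrite -[u]reprK -[v]reprK -[w]reprK.
move: (repr u) (repr v) (repr w) => a b c.
rewrite (madd_pi b c) (madd_pi a b) (madd_pi a (MAdd b c)) madd_pi.
by apply/mquot_eqP; apply: mc_addA.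
Qed.
Lemma maddC : commutative madd.
Proof.
move=> u v; rewrite -[u]reprK -[v]reprK !madd_pi.
by apply/mquot_eqP; apply: mc_addC.
Qed.
Lemma madd0 : left_id mzero madd.
Proof.
by move=> u; rewrite -[u]reprK madd_pi; apply/mquot_eqP; apply: mc_add0.
Qed.
Lemma mscale1 u : mscale 1 u = u.
Proof. by rewrite -[u]reprK mscale_pi; apply/mquot_eqP; apply: mc_scale1. Qed.
Lemma mscale0 u : mscale 0 u = mzero.
Proof. by rewrite -[u]reprK mscale_pi; apply/mquot_eqP; apply: mc_scale0. Qed.
Lemma mscaleDl u : {morph mscale^~ u : a b / a + b >-> madd a b}.
Proof.
move=> a b; rewrite -[u]reprK; move: (repr u) => t.
rewrite !(mscale_pi _ t) madd_pi.
by apply/mquot_eqP; apply: mc_scaleDl.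
Qed.
Lemma mscaleDr c u v : mscale c (madd u v) = madd (mscale c u) (mscale c v).
Proof.
rewrite -[u]reprK -[v]reprK; move: (repr u) (repr v) => a b.
rewrite (madd_pi a b) (mscale_pi c a) (mscale_pi c b) mscale_pi madd_pi.
by apply/mquot_eqP; apply: mc_scaleDr.
Qed.
Lemma mscaleA a b v : mscale a (mscale b v) = mscale (a * b) v.
Proof.
rewrite -[v]reprK; move: (repr v) => t.
rewrite (mscale_pi b t) (mscale_pi (a * b) t) mscale_pi.
by apply/mquot_eqP; apply: mc_scaleA.
Qed.
Lemma maddN : left_inverse mzero (mscale (-1)) madd.
Proof. by move=> u; rewrite -{2}[u]mscale1 -mscaleDl addNr mscale0. Qed.

HB.instance Definition _ := GRing.isZmodule.Build mquot maddA maddC madd0 maddN.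
HB.instance Definition _ := GRing.Zmodule_isLmodule.Build k mquot
  mscaleA mscale1 mscaleDr mscaleDl.

Lemma mgen_lin c s x y t :
  mgen (s ++ (c *: x + y) :: t) = c *: mgen (s ++ x :: t) + mgen (s ++ y :: t).
Proof.
rewrite /GRing.scale /= /GRing.add /= mscale_pi madd_pi.
by apply/mquot_eqP; apply: mc_lin.
Qed.

Lemma mgen_null s : P s -> mgen s = 0.
Proof. by move=> Ps; apply/mquot_eqP; apply: mc_null. Qed.

Lemma mquot_ind (Q : mquot -> Prop) :
    Q 0 -> (forall c u v, Q u -> Q v -> Q (c *: u + v)) ->
    (forall s, ~~ P s -> Q (mgen s)) ->
  forall u, Q u.
Proof.
move=> Q0 Qlin Qgen u; rewrite -[u]reprK.
elim: (repr u) => [s||a IHa b IHb|c a IHa].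
- by have [Ps|/Qgen//] := boolP (P s); rewrite -/(mgen s) mgen_null.
- exact: Q0.
- by rewrite -madd_pi; have := Qlin 1 _ _ IHa IHb; rewrite scale1r.
- by rewrite -mscale_pi; have := Qlin c _ _ IHa Q0; rewrite addr0.
Qed.

Section Lift.
Variable W : lmodType k.

Fixpoint meval (f : seq V -> W) a : W :=
  match a with
  | MGen s => if P s then 0 else f s
  | MZero => 0
  | MAdd a b => meval f a + meval f b
  | MScale c a => c *: meval f a
  end.

(* The linear map [s] |-> f s. *)
Definition mlift f (u : mquot) : W := meval f (repr u).

Definition mcompat (f : seq V -> W) := forall c s x y t,
  let h r := if P r then 0 else f r in
  h (s ++ (c *: x + y) :: t) = c *: h (s ++ x :: t) + h (s ++ y :: t).

Lemma meval_congr f : mcompat f ->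
  forall a b, mcongr a b -> meval f a = meval f b.
Proof.
move=> fP a b; elim=> //=.
- by move=> ? ? ? _ -> _ ->.
- by move=> ? ? ? ? _ -> _ ->.
- by move=> ? ? ? _ ->.
- by move=> *; rewrite addrA.
- by move=> *; rewrite addrC.
- by move=> *; rewrite add0r.
- by move=> *; rewrite scalerA.
- by move=> *; rewrite scale0r.
- by move=> *; rewrite scale1r.
- by move=> *; rewrite scalerDr.
- by move=> *; rewrite scalerDl.
- by move=> s ->.
Qed.

Lemma mlift_gen f s : mcompat f -> ~~ P s -> mlift f (mgen s) = f s.
Proof.
move=> fP Ps; rewrite /mlift (meval_congr fP (mrepr _)) /=.
by rewrite (negPf Ps).
Qed.

Lemma mlift_linear f : mcompat f -> linear (mlift f).
Proof.
move=> fP c u v; rewrite -[u]reprK -[v]reprK.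
rewrite {1}/GRing.scale /= {1}/GRing.add /= mscale_pi madd_pi /mlift.
by rewrite !(meval_congr fP (mrepr _)).
Qed.

End Lift.
End MultilinearQuotient.

Section EnvelopingAlgebra.
Variables (k : fieldType) (g : lieAlgType k).

Inductive uterm : Type :=
| UGen of g
| UZero
| UOne
| UAdd of uterm & uterm
| UMul of uterm & uterm
| UScale of k & uterm.

HB.instance Definition _ := gen_eqMixin uterm.
HB.instance Definition _ := gen_choiceMixin uterm.

Inductive ucongr : uterm -> uterm -> Prop :=
| uc_refl a : ucongr a a
| uc_sym a b : ucongr a b -> ucongr b a
| uc_trans b a c : ucongr a b -> ucongr b c -> ucongr a c
| uc_add a a' b b' : ucongr a a' -> ucongr b b' ->
    ucongr (UAdd a b) (UAdd a' b')
| uc_mul a a' b b' : ucongr a a' -> ucongr b b' ->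
    ucongr (UMul a b) (UMul a' b')
| uc_scale c a a' : ucongr a a' -> ucongr (UScale c a) (UScale c a')
| uc_addA a b c : ucongr (UAdd a (UAdd b c)) (UAdd (UAdd a b) c)
| uc_addC a b : ucongr (UAdd a b) (UAdd b a)
| uc_add0 a : ucongr (UAdd UZero a) a
| uc_scaleA c d a : ucongr (UScale c (UScale d a)) (UScale (c * d) a)
| uc_scale0 a : ucongr (UScale 0 a) UZero
| uc_scale1 a : ucongr (UScale 1 a) a
| uc_scaleDr c a b :
    ucongr (UScale c (UAdd a b)) (UAdd (UScale c a) (UScale c b))
| uc_scaleDl c d a :
    ucongr (UScale (c + d) a) (UAdd (UScale c a) (UScale d a))
| uc_mulA a b c : ucongr (UMul a (UMul b c)) (UMul (UMul a b) c)
| uc_mul1l a : ucongr (UMul UOne a) a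
| uc_mul1r a : ucongr (UMul a UOne) a
| uc_mulDl a b c : ucongr (UMul (UAdd a b) c) (UAdd (UMul a c) (UMul b c))
| uc_mulDr a b c : ucongr (UMul a (UAdd b c)) (UAdd (UMul a b) (UMul a c))
| uc_scaleAl c a b : ucongr (UScale c (UMul a b)) (UMul (UScale c a) b)
| uc_scaleAr c a b : ucongr (UScale c (UMul a b)) (UMul a (UScale c b))
| uc_lin c x y :
    ucongr (UGen (c *: x + y)) (UAdd (UScale c (UGen x)) (UGen y))
| uc_lie x y :
    ucongr (UGen (lie x y))
      (UAdd (UMul (UGen x) (UGen y)) (UScale (-1) (UMul (UGen y) (UGen x)))).

Definition urel a b := `[< ucongr a b >].

Lemma urel_is_equiv : equiv_class_of urel.
Proof.
split=> [a|a b|b a c]; first by apply/asboolP/uc_refl.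
  by apply/asboolP/asboolP; exact: uc_sym.
by move=> /asboolP ab /asboolP bc; apply/asboolP/(uc_trans ab bc).
Qed.

Canonical urel_equiv := EquivRelPack urel_is_equiv.
Canonical urel_encModRel := defaultEncModRel urel.

(* The unital associative k-algebra generated by symbols iota x, linear in
   x : g, subject to iota [x, y] = iota x * iota y - iota y * iota x. *)
Definition uea := {eq_quot urel}.
HB.instance Definition _ := Choice.on uea.
HB.instance Definition _ := EqQuotient.on uea.

Lemma uea_eqP a b : ucongr a b <-> \pi_uea a = \pi_uea b.
Proof.
by split=> [ab|/eqquotP/asboolP//]; apply/eqquotP/asboolP.
Qed.

Definition iota (x : g) : uea := \pi_uea (UGen x).
Definition uzero : uea := \pi_uea UZero.
Definition uone : uea := \pi_uea UOne.
Definition uadd (u v : uea) : uea := \pi_uea (UAdd (repr u) (repr v)).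
Definition umul (u v : uea) : uea := \pi_uea (UMul (repr u) (repr v)).
Definition uscale c (u : uea) : uea := \pi_uea (UScale c (repr u)).

Lemma urepr a : ucongr (repr (\pi_uea a)) a.
Proof. by apply/uea_eqP; rewrite reprK. Qed.

Lemma uadd_pi a b : uadd (\pi_uea a) (\pi_uea b) = \pi_uea (UAdd a b).
Proof. by apply/uea_eqP; apply: uc_add; apply: urepr. Qed.

Lemma umul_pi a b : umul (\pi_uea a) (\pi_uea b) = \pi_uea (UMul a b).
Proof. by apply/uea_eqP; apply: uc_mul; apply: urepr. Qed.

Lemma uscale_pi c a : uscale c (\pi_uea a) = \pi_uea (UScale c a).
Proof. by apply/uea_eqP; apply: uc_scale; apply: urepr. Qed.

Lemma uaddA : associative uadd.
Proof.
move=> u v w; rewrite -[u]reprK -[v]reprK -[w]reprK.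
move: (repr u) (repr v) (repr w) => a b c.
rewrite (uadd_pi b c) (uadd_pi a b) (uadd_pi a (UAdd b c)) uadd_pi.
by apply/uea_eqP; apply: uc_addA.
Qed.
Lemma uaddC : commutative uadd.
Proof.
move=> u v; rewrite -[u]reprK -[v]reprK !uadd_pi.
by apply/uea_eqP; apply: uc_addC.
Qed.
Lemma uadd0 : left_id uzero uadd.
Proof.
by move=> u; rewrite -[u]reprK uadd_pi; apply/uea_eqP; apply: uc_add0.
Qed.
Lemma uscale1 u : uscale 1 u = u.
Proof. by rewrite -[u]reprK uscale_pi; apply/uea_eqP; apply: uc_scale1. Qed.
Lemma uscale0 u : uscale 0 u = uzero.
Proof. by rewrite -[u]reprK uscale_pi; apply/uea_eqP; apply: uc_scale0. Qed.
Lemma uscaleDl u : {morph uscale^~ u : a b / a + b >-> uadd a b}.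
Proof.
move=> a b; rewrite -[u]reprK; move: (repr u) => t.
rewrite !(uscale_pi _ t) uadd_pi.
by apply/uea_eqP; apply: uc_scaleDl.
Qed.
Lemma uscaleDr c u v : uscale c (uadd u v) = uadd (uscale c u) (uscale c v).
Proof.
rewrite -[u]reprK -[v]reprK; move: (repr u) (repr v) => a b.
rewrite (uadd_pi a b) (uscale_pi c a) (uscale_pi c b) uscale_pi uadd_pi.
by apply/uea_eqP; apply: uc_scaleDr.
Qed.
Lemma uscaleA a b v : uscale a (uscale b v) = uscale (a * b) v.
Proof.
rewrite -[v]reprK; move: (repr v) => t.
rewrite (uscale_pi b t) (uscale_pi (a * b) t) uscale_pi.
by apply/uea_eqP; apply: uc_scaleA.
Qed.
Lemma uaddN : left_inverse uzero (uscale (-1)) uadd.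
Proof. by move=> u; rewrite -{2}[u]uscale1 -uscaleDl addNr uscale0. Qed.

Lemma umulA : associative umul.
Proof.
move=> u v w; rewrite -[u]reprK -[v]reprK -[w]reprK.
move: (repr u) (repr v) (repr w) => a b c.
rewrite (umul_pi b c) (umul_pi a b) (umul_pi a (UMul b c)) umul_pi.
by apply/uea_eqP; apply: uc_mulA.
Qed.
Lemma umul1l : left_id uone umul.
Proof.
by move=> u; rewrite -[u]reprK umul_pi; apply/uea_eqP; apply: uc_mul1l.
Qed.
Lemma umul1r : right_id uone umul.
Proof.
by move=> u; rewrite -[u]reprK umul_pi; apply/uea_eqP; apply: uc_mul1r.
Qed.
Lemma umulDl : left_distributive umul uadd.
Proof.
move=> u v w; rewrite -[u]reprK -[v]reprK -[w]reprK.
move: (repr u) (repr v) (repr w) => a b c.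
rewrite (uadd_pi a b) (umul_pi a c) (umul_pi b c) umul_pi uadd_pi.
by apply/uea_eqP; apply: uc_mulDl.
Qed.
Lemma umulDr : right_distributive umul uadd.
Proof.
move=> u v w; rewrite -[u]reprK -[v]reprK -[w]reprK.
move: (repr u) (repr v) (repr w) => a b c.
rewrite (uadd_pi b c) (umul_pi a b) (umul_pi a c) umul_pi uadd_pi.
by apply/uea_eqP; apply: uc_mulDr.
Qed.
Lemma uscaleAl c u v : uscale c (umul u v) = umul (uscale c u) v.
Proof.
rewrite -[u]reprK -[v]reprK; move: (repr u) (repr v) => a b.
rewrite (umul_pi a b) (uscale_pi c a) uscale_pi umul_pi.
by apply/uea_eqP; apply: uc_scaleAl.
Qed.
Lemma uscaleAr c u v : uscale c (umul u v) = umul u (uscale c v).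
Proof.
rewrite -[u]reprK -[v]reprK; move: (repr u) (repr v) => a b.
rewrite (umul_pi a b) (uscale_pi c b) uscale_pi umul_pi.
by apply/uea_eqP; apply: uc_scaleAr.
Qed.

Section Eval.
Variables (A : algType k) (f : g -> A).

Fixpoint ueval a : A :=
  match a with
  | UGen x => f x
  | UZero => 0
  | UOne => 1
  | UAdd a b => ueval a + ueval b
  | UMul a b => ueval a * ueval b
  | UScale c a => c *: ueval a
  end.

(* The algebra morphism iota x |-> f x. *)
Definition ulift (u : uea) : A := ueval (repr u).

Hypothesis f_lin : linear f.
Hypothesis f_lie : forall x y, f (lie x y) = f x * f y - f y * f x.

Lemma ueval_congr a b : ucongr a b -> ueval a = ueval b.
Proof.
elim=> //=.
- by move=> ? ? ? _ -> _ ->.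
- by move=> ? ? ? ? _ -> _ ->.
- by move=> ? ? ? ? _ -> _ ->.
- by move=> ? ? ? _ ->.
- by move=> *; rewrite addrA.
- by move=> *; rewrite addrC.
- by move=> *; rewrite add0r.
- by move=> *; rewrite scalerA.
- by move=> *; rewrite scale0r.
- by move=> *; rewrite scale1r.
- by move=> *; rewrite scalerDr.
- by move=> *; rewrite scalerDl.
- by move=> *; rewrite mulrA.
- by move=> *; rewrite mul1r.
- by move=> *; rewrite mulr1.
- by move=> *; rewrite mulrDl.
- by move=> *; rewrite mulrDr.
- by move=> *; rewrite scalerAl.
- by move=> *; rewrite scalerAr.
- by move=> *; rewrite f_lie scaleN1r.
Qed.

Lemma ulift_pi a : ulift (\pi_uea a) = ueval a.
Proof. exact: ueval_congr (urepr a). Qed.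

End Eval.

Lemma uone_neq0 : uone != uzero.
Proof.
apply/eqP => /uea_eqP e.
have f_lin : linear ((fun=> 0) : g -> k^o).
  by move=> c x y; rewrite scaler0 addr0.
have f_lie (x y : g) : 0 = 0 * 0 - 0 * 0 :> k^o by rewrite mulr0 subr0.
by have /eqP := ueval_congr f_lin f_lie e; rewrite /= oner_eq0.
Qed.

HB.instance Definition _ := GRing.isZmodule.Build uea uaddA uaddC uadd0 uaddN.
HB.instance Definition _ := GRing.Zmodule_isNzRing.Build uea
  umulA umul1l umul1r umulDl umulDr uone_neq0.
HB.instance Definition _ := GRing.Zmodule_isLmodule.Build k uea
  uscaleA uscale1 uscaleDr uscaleDl.
HB.instance Definition _ := GRing.Lmodule_isLalgebra.Build k uea uscaleAl.
HB.instance Definition _ := GRing.Lalgebra_isAlgebra.Build k uea uscaleAr.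

Lemma iota_is_linear : linear iota.
Proof.
move=> c x y; rewrite /GRing.add /GRing.scale /= uscale_pi uadd_pi.
by apply/uea_eqP; apply: uc_lin.
Qed.
HB.instance Definition _ := GRing.isLinear.Build k g uea *:%R iota
  iota_is_linear.

Lemma iota_lie x y : iota (lie x y) = iota x * iota y - iota y * iota x.
Proof.
rewrite -scaleN1r /GRing.add /GRing.scale /GRing.mul /=.
rewrite !umul_pi uscale_pi uadd_pi.
by apply/uea_eqP; apply: uc_lie.
Qed.

Lemma uea_ind (Q : uea -> Prop) :
    Q 0 -> Q 1 -> (forall x, Q (iota x)) ->
    (forall c u v, Q u -> Q v -> Q (c *: u + v)) ->
    (forall u v, Q u -> Q v -> Q (u * v)) ->
  forall u, Q u.
Proof.
move=> Q0 Q1 Qi Qlin Qmul u; rewrite -[u]reprK.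
elim: (repr u) => [x|||a IHa b IHb|a IHa b IHb|c a IHa] //.
- exact: Qi.
- by rewrite -uadd_pi; have := Qlin 1 _ _ IHa IHb; rewrite scale1r.
- by rewrite -umul_pi; apply: Qmul.
- by rewrite -uscale_pi; have := Qlin c _ _ IHa Q0; rewrite addr0.
Qed.

Section LiftMorphism.
Variables (A : algType k) (f : g -> A).
Hypothesis f_lin : linear f.
Hypothesis f_lie : forall x y, f (lie x y) = f x * f y - f y * f x.

Lemma ulift_iota x : ulift f (iota x) = f x.
Proof. exact: (ulift_pi f_lin f_lie (UGen x)). Qed.

Lemma ulift_linear : linear (ulift f).
Proof.
move=> c u v; rewrite -[u]reprK -[v]reprK.
rewrite {1}/GRing.scale /= {1}/GRing.add /= uscale_pi uadd_pi.
by rewrite !(ulift_pi f_lin f_lie).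
Qed.

Lemma ulift_monoid_morphism : monoid_morphism (ulift f).
Proof.
split=> [|u v]; first exact: (ulift_pi f_lin f_lie UOne).
rewrite -[u]reprK -[v]reprK {1}/GRing.mul /= umul_pi.
by rewrite !(ulift_pi f_lin f_lie).
Qed.

End LiftMorphism.
End EnvelopingAlgebra.

Section Multilinear.
Variables (k : fieldType) (V W : lmodType k).

Definition multilinear n (f : seq V -> W) := forall c s x y t,
  (size s + size t).+1 = n ->
  f (s ++ (c *: x + y) :: t) = c *: f (s ++ x :: t) + f (s ++ y :: t).

End Multilinear.

Section TensorPower.
Variables (k : fieldType) (V : lmodType k).

Definition tpow (n : nat) := mquot (fun s : seq V => size s != n).
HB.instance Definition _ n := GRing.Lmodule.on (tpow n).

(* The tensor s_1 (x) ... (x) s_n. The sequence s may have any length, which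
   avoids casts between tensor powers; tens n s = 0 unless s has length n. *)
Definition tens n (s : seq V) : tpow n := mgen _ s.

Definition tlift (W : lmodType k) n (f : seq V -> W) : tpow n -> W := mlift f.

Lemma tens_lin n c s x y t :
  tens n (s ++ (c *: x + y) :: t) =
  c *: tens n (s ++ x :: t) + tens n (s ++ y :: t).
Proof. exact: mgen_lin. Qed.

Lemma tens_size n s : size s != n -> tens n s = 0.
Proof. by move=> sn; apply: mgen_null. Qed.

Lemma tpow_ind n (Q : tpow n -> Prop) :
    (forall c u v, Q u -> Q v -> Q (c *: u + v)) ->
    (forall s, size s = n -> Q (tens n s)) ->
  forall u, Q u.
Proof.
move=> Qlin Qgen; apply: mquot_ind => // [|s /negPn/eqP]; last exact: Qgen.
have := Qgen (nseq n 0) (size_nseq _ _).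
by move=> /[dup]/(Qlin (-1))/[apply]; rewrite scaleN1r addNr.
Qed.

Lemma multilinear_mcompat (W : lmodType k) n (f : seq V -> W) :
  multilinear n f -> mcompat (fun s => size s != n) f.
Proof.
move=> fP c s x y t /=; rewrite !size_cat /= !addnS.
by case: eqP => [/fP|_] /=; rewrite ?scaler0 ?addr0.
Qed.

Lemma tlift_tens (W : lmodType k) n (f : seq V -> W) s :
  multilinear n f -> size s = n -> tlift f (tens n s) = f s.
Proof.
by move=> fP sn; rewrite [LHS]mlift_gen ?sn ?eqxx//; apply: multilinear_mcompat.
Qed.

Lemma tlift_is_linear (W : lmodType k) n (f : seq V -> W) :
  multilinear n f -> linear (@tlift W n f).
Proof. by move=> fP; apply/mlift_linear/multilinear_mcompat. Qed.

Lemma eq_tlift (W : lmodType k) n (f h : seq V -> W) :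
  f =1 h -> @tlift W n f =1 tlift h.
Proof.
move=> fh u; rewrite /tlift /mlift.
by elim: (repr u) => //= [s|a -> b ->//|c a ->//]; rewrite fh.
Qed.

Lemma tlift_lin (W : lmodType k) n (f h : seq V -> W) c (u : tpow n) :
  tlift (fun s => c *: f s + h s) u = c *: tlift f u + tlift h u.
Proof.
rewrite /tlift /mlift; elim: (repr u) => //= [s||a IHa b IHb|d a IHa].
- by case: ifP; rewrite ?scaler0 ?addr0.
- by rewrite scaler0 addr0.
- by rewrite IHa IHb scalerDr addrACA.
- by rewrite IHa scalerDr !scalerA mulrC.
Qed.

(* l (x) u (x) r, for sequences of vectors l and r; the target is to be taken
   with N = size l + n + size r. *)
Definition tsplice n N (l r : seq V) (u : tpow n) : tpow N :=
  tlift (fun s => tens N (l ++ s ++ r)) u.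

Lemma tsplice_multilinear n N l r :
  multilinear n (fun s => tens N (l ++ s ++ r)).
Proof.
move=> c s x y t _.
by rewrite -!catA !cat_cons (catA l s) tens_lin !catA.
Qed.

Lemma tsplice_tens n N l r s : size s = n ->
  tsplice N l r (tens n s) = tens N (l ++ s ++ r).
Proof. exact/tlift_tens/tsplice_multilinear. Qed.

Lemma tsplice_is_linear n N l r : linear (@tsplice n N l r).
Proof. exact/tlift_is_linear/tsplice_multilinear. Qed.
HB.instance Definition _ n N l r :=
  GRing.isLinear.Build k (tpow n) (tpow N) *:%R (@tsplice n N l r)
    (tsplice_is_linear N l r).

Lemma tsplice_linl n N c s x y t r (u : tpow n) :
  tsplice N (s ++ (c *: x + y) :: t) r u =
  c *: tsplice N (s ++ x :: t) r u + tsplice N (s ++ y :: t) r u.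
Proof.
rewrite -tlift_lin; apply: eq_tlift => w.
by rewrite -!catA !cat_cons tens_lin.
Qed.

Lemma tsplice_linr n N c l s x y t (u : tpow n) :
  tsplice N l (s ++ (c *: x + y) :: t) u =
  c *: tsplice N l (s ++ x :: t) u + tsplice N l (s ++ y :: t) u.
Proof.
rewrite -tlift_lin; apply: eq_tlift => w.
by rewrite !catA tens_lin.
Qed.

(* id^p (x) F (x) id^(n-p-1) : V^n -> V^N, where F : V -> V^q; the target is to
   be taken with N = n + q - 1. *)
Definition tslot n N p q (F : V -> tpow q) (u : tpow n) : tpow N :=
  tlift (fun s => tsplice N (take p s) (drop p.+1 s) (F (nth 0 s p))) u.

Lemma tslot_multilinear n N p q (F : {linear V -> tpow q}) :
  multilinear n
    (fun s => tsplice N (take p s) (drop p.+1 s) (F (nth 0 s p))).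
Proof.
move=> c s x y t _.
have [ps|sp|ps] := ltngtP p (size s).
- rewrite !take_cat !drop_cat !nth_cat ps.
  rewrite ltn_neqAle ps andbT; case: eqP => [e|_]; last exact: tsplice_linr.
  by rewrite e subnn !drop0; exact: (@tsplice_linr _ _ c _ [::]).
- rewrite !take_cat !drop_cat !nth_cat !ltnNge (ltnW sp) (leqW (ltnW sp)) /=.
  have [d ->] : exists d, p = (size s + d.+1)%N.
    by exists (p - (size s).+1)%N; rewrite addnS -addSn subnKC.
  rewrite -addnS !addKn /=; exact: tsplice_linl.
- rewrite ps !take_size_cat // !drop_cat !nth_cat ltnn ltnNge leqnSn /=.
  by rewrite subnn subSnn /= !drop0 !linearP.
Qed.

Lemma tslot_tens n N p q (F : {linear V -> tpow q}) s : size s = n ->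
  tslot N p F (tens n s) = tsplice N (take p s) (drop p.+1 s) (F (nth 0 s p)).
Proof. exact/tlift_tens/tslot_multilinear. Qed.

Lemma tslot_is_linear n N p q (F : {linear V -> tpow q}) :
  linear (@tslot n N p q F).
Proof. exact/tlift_is_linear/tslot_multilinear. Qed.
HB.instance Definition _ n N p q (F : {linear V -> tpow q}) :=
  GRing.isLinear.Build k (tpow n) (tpow N) *:%R (@tslot n N p q F)
    (tslot_is_linear N p F).

End TensorPower.

Section TensorPowerAlgebra.
Variables (k : fieldType) (A : algType k) (n : nat).
Implicit Types (s t : seq A) (u v w : tpow A n).

Definition zipmul s t := [seq p.1 * p.2 | p <- zip s t].

Definition tmul u v : tpow A n :=
  tlift (fun s => tlift (fun t => tens n (zipmul s t)) v) u.

Definition tone : tpow A n := tens n (nseq n 1).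

Lemma size_zipmul s t : size s = size t -> size (zipmul s t) = size t.
Proof. by move=> e; rewrite size_map size2_zip ?e. Qed.

Lemma zipmul_cat s1 s2 t1 t2 : size s1 = size t1 ->
  zipmul (s1 ++ s2) (t1 ++ t2) = zipmul s1 t1 ++ zipmul s2 t2.
Proof. by move=> e; rewrite /zipmul zip_cat // map_cat. Qed.

Lemma zipmul_cons x s y t : zipmul (x :: s) (y :: t) = x * y :: zipmul s t.
Proof. by []. Qed.

Lemma zipmulA s t r : zipmul s (zipmul t r) = zipmul (zipmul s t) r.
Proof.
by elim: s t r => [|x s IH] [|y t] [|z r] //; rewrite !zipmul_cons mulrA IH.
Qed.

Lemma zipmul1l s : zipmul (nseq (size s) 1) s = s.
Proof. by elim: s => //= x s IH; rewrite zipmul_cons mul1r IH. Qed.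

Lemma zipmul1r s : zipmul s (nseq (size s) 1) = s.
Proof. by elim: s => //= x s IH; rewrite zipmul_cons mulr1 IH. Qed.

Lemma zipmul_multilinearr s : size s = n ->
  multilinear n (fun t => tens n (zipmul s t)).
Proof.
move=> sn c t x y r trn.
have lt : (size t < size s)%N by rewrite sn -trn ltnS leq_addr.
rewrite -(cat_take_drop (size t) s) (drop_nth 0) //.
have e1 : size (take (size t) s) = size t by rewrite size_takel // ltnW.
rewrite !zipmul_cat // !zipmul_cons mulrDr -scalerAr.
exact: tens_lin.
Qed.

Lemma zipmul_multilinearl (v : tpow A n) :
  multilinear n (fun s => tlift (fun t => tens n (zipmul s t)) v).
Proof.
move=> c s x y t stn.
have sz z : size (s ++ z :: t) = n by rewrite size_cat addnS.
elim/tpow_ind: v => [d u v IHu IHv|r rn].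
  rewrite !(tlift_is_linear (zipmul_multilinearr (sz _))) IHu IHv.
  by rewrite !scalerDr !scalerA (mulrC d) addrACA.
rewrite !(tlift_tens (zipmul_multilinearr (sz _))) //.
have lt : (size s < size r)%N by rewrite rn -stn ltnS leq_addr.
rewrite -(cat_take_drop (size s) r) (drop_nth 0) //.
have e1 : size s = size (take (size s) r) by rewrite size_takel // ltnW.
rewrite !zipmul_cat // !zipmul_cons mulrDl -scalerAl.
exact: tens_lin.
Qed.

Lemma tmul_tens s t : size s = n -> size t = n ->
  tmul (tens n s) (tens n t) = tens n (zipmul s t).
Proof.
move=> sn tn; rewrite /tmul (tlift_tens (zipmul_multilinearl _)) //.
by rewrite (tlift_tens (zipmul_multilinearr _)).
Qed.

Lemma tmul_linl c u v w : tmul (c *: u + v) w = c *: tmul u w + tmul v w.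
Proof. exact: (tlift_is_linear (zipmul_multilinearl _)). Qed.

Lemma tmul_linr c u v w : tmul u (c *: v + w) = c *: tmul u v + tmul u w.
Proof.
elim/tpow_ind: u => [d u u' IH IH'|s sn].
  by rewrite !tmul_linl IH IH' !scalerDr !scalerA (mulrC c) addrACA.
rewrite /tmul !(tlift_tens (zipmul_multilinearl _)) //.
exact: (tlift_is_linear (zipmul_multilinearr sn)).
Qed.

Lemma tmulDl : left_distributive tmul +%R.
Proof. by move=> u v w; have := tmul_linl 1 u v w; rewrite !scale1r. Qed.
Lemma tmulDr : right_distributive tmul +%R.
Proof. by move=> u v w; have := tmul_linr 1 u v w; rewrite !scale1r. Qed.
Lemma tmul0 u : tmul 0 u = 0.
Proof. by have := tmul_linl (-1) u u u; rewrite !scaleN1r !addNr. Qed.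
Lemma tmul_0 u : tmul u 0 = 0.
Proof. by have := tmul_linr (-1) u u u; rewrite !scaleN1r !addNr. Qed.
Lemma tscaleAl c u v : c *: tmul u v = tmul (c *: u) v.
Proof. by have := tmul_linl c u 0 v; rewrite !addr0 tmul0 addr0. Qed.
Lemma tscaleAr c u v : c *: tmul u v = tmul u (c *: v).
Proof. by have := tmul_linr c u v 0; rewrite !addr0 tmul_0 addr0. Qed.

Lemma tmulA : associative tmul.
Proof.
move=> u v w; elim/tpow_ind: u => [c u u' IH IH'|s sn].
  by rewrite !tmul_linl IH IH'.
elim/tpow_ind: v => [c v v' IH IH'|t tn].
  by rewrite tmul_linl !tmul_linr tmul_linl IH IH'.
elim/tpow_ind: w => [c w w' IH IH'|r rn].
  by rewrite !tmul_linr IH IH'.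
by rewrite !tmul_tens ?size_zipmul ?sn ?tn ?rn // zipmulA.
Qed.

Lemma tmul1l : left_id tone tmul.
Proof.
move=> u; elim/tpow_ind: u => [c u v IH IH'|s sn].
  by rewrite tmul_linr IH IH'.
rewrite tmul_tens ?size_nseq //; congr tens.
by rewrite -[X in nseq X]sn zipmul1l.
Qed.

Lemma tmul1r : right_id tone tmul.
Proof.
move=> u; elim/tpow_ind: u => [c u v IH IH'|s sn].
  by rewrite tmul_linl IH IH'.
rewrite tmul_tens ?size_nseq //; congr tens.
by rewrite -[X in nseq X]sn zipmul1r.
Qed.

End TensorPowerAlgebra.

Section Coproduct.
Variables (k : fieldType) (g : lieAlgType k).

Definition counit : uea g -> k^o := ulift (fun=> 0).

Let counit_lin : linear ((fun=> 0) : g -> k^o).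
Proof. by move=> c x y; rewrite scaler0 addr0. Qed.
Let counit_lie (x y : g) : 0 = 0 * 0 - 0 * 0 :> k^o.
Proof. by rewrite mulr0 subr0. Qed.

HB.instance Definition _ := GRing.isLinear.Build k (uea g) k^o *:%R counit
  (ulift_linear counit_lin counit_lie).
HB.instance Definition _ := GRing.isMonoidMorphism.Build (uea g) k^o counit
  (ulift_monoid_morphism counit_lin counit_lie).

Lemma counit_iota x : counit (iota x) = 0.
Proof. exact: ulift_iota counit_lin counit_lie x. Qed.

(* End(F^n) for the forgetful functor F : Rep(g) -> Vect, identified with
   U(g)^n by evaluation on the regular module. *)
Definition cochain n := tpow (uea g) n.
HB.instance Definition _ n := GRing.Lmodule.on (cochain n).

Lemma prod_counit_multilinear n :
  multilinear n (fun s : seq (uea g) => \prod_(x <- s) (counit x : k^o)).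
Proof.
move=> c s x y t _; rewrite !big_cat !big_cons linearP /=.
by rewrite mulrDl mulrDr -scalerAl -scalerAr.
Qed.

Lemma tone_neq0 n : tone (uea g) n != 0.
Proof.
have fP := @prod_counit_multilinear n.
apply/eqP => /(congr1 (tlift (fun s => \prod_(x <- s) (counit x : k^o)))).
rewrite (tlift_tens fP) ?size_nseq // big_nseq rmorph1 iter_mulr expr1n mulr1.
have -> : tlift (fun s => \prod_(x <- s) (counit x : k^o)) (0 : tpow _ n) = 0.
  have := tlift_is_linear fP (-1) 0 0.
  by rewrite scaler0 addr0 scaleN1r addNr.
by move/eqP; rewrite oner_eq0.
Qed.

HB.instance Definition _ n := GRing.Zmodule_isNzRing.Build (cochain n)
  (@tmulA _ _ n) (@tmul1l _ _ n) (@tmul1r _ _ n) (@tmulDl _ _ n)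
  (@tmulDr _ _ n) (tone_neq0 n).
HB.instance Definition _ n := GRing.Lmodule_isLalgebra.Build k (cochain n)
  (@tscaleAl _ _ n).
HB.instance Definition _ n := GRing.Lalgebra_isAlgebra.Build k (cochain n)
  (@tscaleAr _ _ n).

Definition primitive2 (x : g) : cochain 2 :=
  tens 2 [:: iota x; 1] + tens 2 [:: 1; iota x].

Definition coproduct : uea g -> cochain 2 := ulift primitive2.

Lemma primitive2_linear : linear primitive2.
Proof.
move=> c x y; rewrite /primitive2 linearP.
have := @tens_lin _ (uea g) 2 c [::] (iota x) (iota y) [:: 1].
have := @tens_lin _ (uea g) 2 c [:: 1] (iota x) (iota y) [::].
by move=> /= -> ->; rewrite scalerDr addrACA.
Qed.

Lemma cochain_mul_tens n (s t : seq (uea g)) : size s = n -> size t = n ->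
  (tens n s : cochain n) * tens n t = tens n (zipmul s t).
Proof. exact: tmul_tens. Qed.

Lemma primitive2_lie x y :
  primitive2 (lie x y) =
  primitive2 x * primitive2 y - primitive2 y * primitive2 x.
Proof.
rewrite /primitive2 !mulrDl !mulrDr !cochain_mul_tens //= /zipmul /=.
rewrite !(mul1r, mulr1) iota_lie.
set ixy := iota x * iota y; set iyx := iota y * iota x.
have := @tens_lin _ (uea g) 2 (-1) [::] iyx ixy [:: 1].
have := @tens_lin _ (uea g) 2 (-1) [:: 1] iyx ixy [::].
rewrite /= -/ixy -/iyx [ixy - _]addrC -scaleN1r => -> ->.
rewrite !scaleN1r !opprD.
rewrite [RHS](AC ((2*2)*(2*2)) ((5*1)*(8*4)*(2*7)*(3*6))) /=.
by rewrite !subrr !addr0.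
Qed.

HB.instance Definition _ := GRing.isLinear.Build k (uea g) (cochain 2) *:%R
  coproduct (ulift_linear primitive2_linear primitive2_lie).
HB.instance Definition _ := GRing.isMonoidMorphism.Build (uea g) (cochain 2)
  coproduct (ulift_monoid_morphism primitive2_linear primitive2_lie).
End Coproduct.

Section Bracket.
Variables (k : fieldType) (g : lieAlgType k).

(* iter_coproduct n is Delta^(n-1) : U(g) -> U(g)^n, with Delta^(-1) the
   counit. *)
Fixpoint iter_coproduct n : uea g -> cochain g n :=
  match n with
  | 0 => fun u => (counit u : k) *: (1 : cochain g 0)
  | n'.+1 =>
    match n' return (uea g -> cochain g n') -> uea g -> cochain g n'.+1 with
    | 0 => fun _ u => tens 1 [:: u]
    | m.+1 => fun iter u => tslot m.+2 0 (@coproduct k g) (iter u)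
    end (@iter_coproduct n')
  end.

Definition differential n (a : cochain g n) : cochain g n.+1 :=
  tsplice n.+1 [:: 1] [::] a
  + \sum_(i < n) (-1) ^+ i.+1 *: tslot n.+1 i (@coproduct k g) a
  + (-1) ^+ n.+1 *: tsplice n.+1 [::] [:: 1] a.

(* Positions are counted from 0: circ_at N i a b is a o_(i+1) b for
   N = m + n - 1. *)
Definition circ_at m n N i (a : cochain g m) (b : cochain g n) : cochain g N :=
  (tslot N i (@iter_coproduct n) a : cochain g N)
  * tsplice N (nseq i 1) (nseq (m - i.+1) 1) b.

(* The sign of a o_i b, i = 1, ..., m, is (-1)^((n-1)(m-i)), which is
   Gerstenhaber's sign (-1)^((n-1)(i-1)) times (-1)^((n-1)(m-1)). The sign
   (-1)^((n-1)i) differs from it when m is odd and n is even; with that sign the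
   bracket of cocycles whose degrees have different parities is in general not
   a cocycle, e.g. {x1 (x) x2, y}. For equal parities both signs give the same
   bracket, see bracket_same_parity. In exponents n.+1 stands for n - 1, which
   would be truncated at n = 0. *)
Definition circ m n N (a : cochain g m) (b : cochain g n) : cochain g N :=
  \sum_(i < m) (-1) ^+ (n.+1 * (m - i.+1)) *: circ_at N i a b.

Definition bracket m n (a : cochain g m) (b : cochain g n) :
    cochain g (m + n).-1 :=
  circ _ a b - (-1) ^+ (n.+1 * m.+1) *: circ _ b a.

Lemma bracket_same_parity m n (a : cochain g m) (b : cochain g n) :
  odd m = odd n ->
  bracket a b =
    \sum_(i < m) (-1) ^+ (n.+1 * i.+1) *: circ_at _ i a b
    - (-1) ^+ (n.+1 * m.+1) *:
      \sum_(i < n) (-1) ^+ (m.+1 * i.+1) *: circ_at _ i b a.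
Proof.
have sgn p q i : odd p = odd q -> (i < p)%N ->
    (-1) ^+ (q.+1 * (p - i.+1)) = (-1) ^+ (q.+1 * i.+1) :> k.
  move=> e ip; rewrite -[LHS]signr_odd -[RHS]signr_odd !oddM oddB //= -e.
  by case: (odd p) (odd i) => [] [].
by move=> e; congr (_ - _ *: _); apply: eq_bigr => i _; rewrite sgn.
Qed.

Lemma differential_is_linear n : linear (@differential n).
Proof.
move=> c a b; rewrite /differential.
under eq_bigr => i _ do rewrite linearP scalerDr scalerA mulrC -scalerA.
rewrite big_split /= -scaler_sumr !linearP /= !scalerDr !scalerA.
by rewrite [LHS](AC (2*2*2) ((1*3*5)*(2*4*6))).
Qed.
HB.instance Definition _ n := GRing.isLinear.Build k (cochain g n)
  (cochain g n.+1) *:%R (@differential n) (@differential_is_linear n).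

Definition cocycle n : pred (cochain g n) := fun a => differential a == 0.
Arguments cocycle {n} a.

Definition coboundary n : cochain g n -> Prop :=
  match n with
  | 0 => fun a => a = 0
  | m.+1 => fun a => exists c : cochain g m, a = differential c
  end.

Lemma coboundary0 n : coboundary (0 : cochain g n).
Proof. by case: n => //= n; exists 0; rewrite linear0. Qed.

Lemma coboundary_lin n c (a b : cochain g n) :
  coboundary a -> coboundary b -> coboundary (c *: a + b).
Proof.
case: n a b => [a b /= -> ->|n a b [a' ->] [b' ->]].
  by rewrite scaler0 addr0.
by exists (c *: a' + b'); rewrite linearP.
Qed.

Lemma cocycle_submod n : submod_closed (@cocycle n).
Proof.
split=> [|c a b /eqP ha /eqP hb]; first by apply/eqP; rewrite linear0.
by apply/eqP; rewrite linearP /= ha hb scaler0 addr0.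
Qed.
HB.instance Definition _ n :=
  GRing.isSubmodClosed.Build k (cochain g n) (@cocycle n) (@cocycle_submod n).

Definition cocycles n := {a : cochain g n | cocycle a}.
HB.instance Definition _ n := SubChoice.on (cocycles n).
HB.instance Definition _ n := [SubChoice_isSubLmodule of cocycles n by <:].

Definition cohomologous n (a b : cocycles n) :=
  `[< coboundary (val a - val b) >].

Lemma cohomologous_is_equiv n : equiv_class_of (@cohomologous n).
Proof.
split=> [a|a b|b a c].
- by apply/asboolP; rewrite subrr; apply: coboundary0.
- have sym (u v : cocycles n) : cohomologous u v -> cohomologous v u.
    move=> /asboolP h; apply/asboolP.
    have := coboundary_lin (-1) h (@coboundary0 n).
    by rewrite addr0 scaleN1r opprB.
  by apply/idP/idP; apply: sym.
- move=> /asboolP h /asboolP h'; apply/asboolP.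
  by have := coboundary_lin 1 h h'; rewrite scale1r addrA subrK.
Qed.

Canonical cohomologous_equiv n := EquivRelPack (@cohomologous_is_equiv n).
Canonical cohomologous_encModRel n := defaultEncModRel (@cohomologous n).

Definition cohomology n := {eq_quot @cohomologous n}.
HB.instance Definition _ n := Choice.on (cohomology n).
HB.instance Definition _ n := EqQuotient.on (cohomology n).

Section Module.
Variable n : nat.
Local Notation H := (cohomology n).
Implicit Types (a b : cocycles n) (u v w : H).

Lemma cohomology_eqP a b :
  coboundary (val a - val b) <-> \pi_H a = \pi_H b.
Proof. by split=> [ab|/eqquotP/asboolP//]; apply/eqquotP/asboolP. Qed.

Definition hadd u v : H := \pi_H (repr u + repr v).
Definition hscale c u : H := \pi_H (c *: repr u).

Lemma hrepr a : coboundary (val (repr (\pi_H a)) - val a).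
Proof. by apply/cohomology_eqP; rewrite reprK. Qed.

Lemma hadd_pi a b : hadd (\pi_H a) (\pi_H b) = \pi_H (a + b).
Proof.
apply/cohomology_eqP; rewrite !raddfD /= addrACA.
by have := coboundary_lin 1 (hrepr a) (hrepr b); rewrite scale1r.
Qed.

Lemma hscale_pi c a : hscale c (\pi_H a) = \pi_H (c *: a).
Proof.
apply/cohomology_eqP; rewrite !linearZ /= -scalerDr.
by have := coboundary_lin c (hrepr a) (@coboundary0 n); rewrite addr0.
Qed.

Lemma haddA : associative hadd.
Proof.
move=> u v w; rewrite -[u]reprK -[v]reprK -[w]reprK.
move: (repr u) (repr v) (repr w) => a b c.
by rewrite (hadd_pi b c) (hadd_pi a b) (hadd_pi a (b + c)) hadd_pi addrA.
Qed.
Lemma haddC : commutative hadd.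
Proof. by move=> u v; rewrite /hadd addrC. Qed.
Lemma hadd0 : left_id (\pi_H 0) hadd.
Proof. by move=> u; rewrite -[u]reprK hadd_pi add0r. Qed.
Lemma haddN : left_inverse (\pi_H 0) (hscale (-1)) hadd.
Proof.
move=> u; rewrite -[u]reprK; move: (repr u) => a.
by rewrite (hscale_pi _ a) hadd_pi scaleN1r addNr.
Qed.
Lemma hscaleA c d v : hscale c (hscale d v) = hscale (c * d) v.
Proof.
rewrite -[v]reprK; move: (repr v) => t.
by rewrite (hscale_pi d t) (hscale_pi (c * d) t) hscale_pi scalerA.
Qed.
Lemma hscale1 : left_id 1 hscale.
Proof. by move=> u; rewrite /hscale scale1r reprK. Qed.
Lemma hscaleDr : right_distributive hscale hadd.
Proof.
move=> c u v; rewrite -[u]reprK -[v]reprK; move: (repr u) (repr v) => a b.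
rewrite (hadd_pi a b) (hscale_pi c a) (hscale_pi c b) hscale_pi hadd_pi.
by rewrite scalerDr.
Qed.
Lemma hscaleDl u : {morph hscale^~ u : a b / a + b >-> hadd a b}.
Proof.
move=> a b; rewrite -[u]reprK; move: (repr u) => t.
by rewrite !(hscale_pi _ t) hadd_pi scalerDl.
Qed.

HB.instance Definition _ := GRing.isZmodule.Build H haddA haddC hadd0 haddN.
HB.instance Definition _ := GRing.Zmodule_isLmodule.Build k H
  hscaleA hscale1 hscaleDr hscaleDl.

(* The class of a cocycle (0 on other cochains). *)
Definition hclass (a : cochain g n) : H := \pi_H (insubd (0 : cocycles n) a).

Lemma hclassE (a b : cochain g n) : cocycle a -> cocycle b ->
  hclass a = hclass b <-> coboundary (a - b).
Proof.
move=> za zb; rewrite /hclass.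
have ea : val (insubd (0 : cocycles n) a) = a by rewrite insubdK.
have eb : val (insubd (0 : cocycles n) b) = b by rewrite insubdK.
by rewrite -[in coboundary _]ea -[in coboundary _]eb cohomology_eqP.
Qed.

Lemma hclass_lin c (a b : cochain g n) : cocycle a -> cocycle b ->
  hclass (c *: a + b) = c *: hclass a + hclass b.
Proof.
move=> za zb; rewrite -[RHS]/(hadd (hscale c (hclass a)) (hclass b)).
rewrite /hclass hscale_pi hadd_pi; congr \pi_H; apply: val_inj.
rewrite linearP /= !insubdK //.
by have [_ h] := @cocycle_submod n; rewrite unfold_in; exact: (h c a b).
Qed.

Lemma hclass_surj u : exists2 a : cochain g n, cocycle a & u = hclass a.
Proof.
exists (val (repr u)); first exact: (valP (repr u)).
by rewrite /hclass valKd reprK.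
Qed.

End Module.

(* The operation induced by bracket on cohomology, computed on chosen
   representatives. *)
Definition hbracket m n (u : cohomology m) (v : cohomology n) :
    cohomology (m + n).-1 :=
  hclass (bracket (val (repr u)) (val (repr v))).

End Bracket.
Arguments cocycle {k g n} a.

Section ExteriorPower.
Variables (k : fieldType) (V : lmodType k).

Definition ext (n : nat) := mquot (fun s : seq V => (size s != n) || ~~ uniq s).
HB.instance Definition _ n := GRing.Lmodule.on (ext n).

(* s_1 /\ ... /\ s_n if s has length n, and 0 otherwise. *)
Definition wedge n (s : seq V) : ext n := mgen _ s.

Definition elift (W : lmodType k) n (f : seq V -> W) : ext n -> W := mlift f.

Definition alternating (W : lmodType k) n (f : seq V -> W) :=
  multilinear n f /\ forall s, size s = n -> ~~ uniq s -> f s = 0.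

Lemma alternating_mcompat (W : lmodType k) n (f : seq V -> W) :
  alternating n f -> mcompat (fun s => (size s != n) || ~~ uniq s) f.
Proof.
move=> [fl fa] c s x y t.
have e r : (if (size r != n) || ~~ uniq r then 0 else f r) =
    if size r != n then 0 else f r.
  by have [/= /fa h|] := eqVneq (size r) n; first by case: ifP => // /h.
rewrite /= !e; exact: multilinear_mcompat.
Qed.

Lemma wedge_alternating n : alternating n (wedge n).
Proof.
split=> [c s x y t _|s _ us]; first exact: mgen_lin.
by apply: mgen_null; rewrite us orbT.
Qed.

Lemma elift_wedge (W : lmodType k) n (f : seq V -> W) s :
  alternating n f -> size s = n -> elift f (wedge n s) = f s.
Proof.
move=> fP sn; have [us|us] := boolP (uniq s).
  by rewrite [LHS]mlift_gen ?sn ?eqxx ?us //; apply: alternating_mcompat.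
have [_ ->//] := wedge_alternating n.
rewrite (proj2 fP) //.
have := mlift_linear (alternating_mcompat fP) (-1) 0 0.
by rewrite scaler0 addr0 scaleN1r addNr.
Qed.

Lemma elift_is_linear (W : lmodType k) n (f : seq V -> W) :
  alternating n f -> linear (@elift W n f).
Proof. by move=> fP; apply/mlift_linear/alternating_mcompat. Qed.

Lemma ext_ind n (Q : ext n -> Prop) :
    Q 0 -> (forall c u v, Q u -> Q v -> Q (c *: u + v)) ->
    (forall s, size s = n -> Q (wedge n s)) ->
  forall u, Q u.
Proof.
move=> Q0 Qlin Qgen; apply: mquot_ind => // s.
by rewrite negb_or => /andP[/negPn/eqP sn _]; apply: Qgen.
Qed.

Section Alternating.
Variables (W : lmodType k) (n : nat) (f : seq V -> W).
Hypothesis fP : alternating n f.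

Lemma alternating_swap s x y t : (size s + size t).+2 = n ->
  f (s ++ x :: y :: t) = - f (s ++ y :: x :: t).
Proof.
move=> stn; have [fl fa] := fP.
have sz (z w : V) : size (s ++ z :: w :: t) = n by rewrite size_cat /= !addnS.
have f0 z : f (s ++ z :: z :: t) = 0.
  by rewrite fa // cat_uniq /= inE eqxx !andbF.
have l1 z w v : f (s ++ (z + w) :: v :: t) =
    f (s ++ z :: v :: t) + f (s ++ w :: v :: t).
  by have := fl 1 s z w (v :: t); rewrite !scale1r /= addnS; apply.
have l2 z w v : f (s ++ v :: (z + w) :: t) =
    f (s ++ v :: z :: t) + f (s ++ v :: w :: t).
  have := fl 1 (rcons s v) z w t.
  by rewrite !scale1r size_rcons !cat_rcons addSn; apply.
have := f0 (x + y); rewrite l1 !l2 !f0 add0r addr0 => /eqP.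
by rewrite addr_eq0 => /eqP.
Qed.

End Alternating.

Lemma swap_move (W : lmodType k) n (f : seq V -> W) :
    (forall s x y t, (size s + size t).+2 = n ->
       f (s ++ x :: y :: t) = - f (s ++ y :: x :: t)) ->
  forall a s z b, (size a + size s + size b).+1 = n ->
  f (a ++ s ++ z :: b) = (-1) ^+ size s *: f (a ++ z :: s ++ b).
Proof.
move=> swap a s z b; elim: s a => [|x s IH] a /= e; first by rewrite scale1r.
rewrite -cat_rcons IH; last by rewrite size_rcons -e !addnS !addSn.
rewrite cat_rcons swap; last by rewrite size_cat -e !addnS addSn addnA.
by rewrite exprS mulN1r scaleNr scalerN.
Qed.

Lemma not_uniqP (s : seq V) : ~~ uniq s ->
  exists s1 x s2 s3, s = s1 ++ x :: s2 ++ x :: s3.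
Proof.
elim: s => //= x s IH; rewrite negb_and negbK => /orP[|/IH].
  by case/splitPr => s2 s3; exists [::], x, s2, s3.
by move=> [s1 [y [s2 [s3 ->]]]]; exists (x :: s1), y, s2, s3.
Qed.

Definition omit i (s : seq V) := take i s ++ drop i.+1 s.

Lemma omit_lt i s t : (i < size s)%N -> omit i (s ++ t) = omit i s ++ t.
Proof.
move=> lt; rewrite /omit take_cat lt drop_cat.
case: ltnP => [_|ge]; first by rewrite catA.
have -> : i.+1 = size s by apply/eqP; rewrite eqn_leq lt.
by rewrite subnn drop0 drop_size cats0.
Qed.

Lemma omit_ge s x t : omit (size s) (s ++ x :: t) = s ++ t.
Proof.
by rewrite /omit take_size_cat // -cat_rcons -(size_rcons s x) drop_size_cat.
Qed.

Lemma omit_gt i s x t :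
  omit ((size s).+1 + i) (s ++ x :: t) = s ++ x :: omit i t.
Proof.
rewrite /omit -cat_rcons -(size_rcons s x) -addnS take_cat drop_cat.
by rewrite !ltnNge !leq_addr /= !addKn -!cat_rcons catA.
Qed.

Lemma size_omit i s : (i < size s)%N -> size (omit i s) = (size s).-1.
Proof.
move=> lt; rewrite size_cat size_takel ?(ltnW lt) // size_drop.
by case: (size s) lt => // m; rewrite ltnS subSS => /subnKC.
Qed.

Lemma contraction_alternating (W : lmodType k) n (K : V -> seq V -> W) :
    (forall r, size r = n.-1 -> linear (K^~ r)) ->
    (forall z, alternating n.-1 (K z)) ->
  alternating n (fun s =>
    \sum_(i < n) (-1) ^+ i *: K (nth 0 s i) (omit i s)).
Proof.
move=> Klin Kalt; split=> [c s x y t stn|s sn /not_uniqP].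
  rewrite scaler_sumr -big_split /=; apply: eq_bigr => i _.
  rewrite scalerA mulrC -scalerA -scalerDr; congr (_ *: _).
  have [lt|gt|->] := ltngtP i (size s).
  - rewrite !nth_cat lt !omit_lt //; apply: (proj1 (Kalt _)).
    by rewrite size_omit // -stn /=; case: (size s) lt.
  - have [j ej] : exists j, nat_of_ord i = ((size s).+1 + j)%N.
      by exists (i - (size s).+1)%N; rewrite subnKC.
    rewrite ej !omit_gt !nth_cat addSn ltnNge leqW ?leq_addr //=.
    rewrite -addnS addKn /=; apply: (proj1 (Kalt _)).
    have jt : (j < size t)%N.
      have := ltn_ord i.
      by rewrite ej -[X in (_ < X)%N]stn addSn ltnS ltn_add2l.
    by rewrite size_omit // -stn -addnS prednK // (leq_trans _ jt).
  - rewrite !nth_cat ltnn subnn /= !omit_ge; apply: Klin.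
    by rewrite size_cat -stn.
move=> [s1 [z [s2 [s3 es]]]].
have sz : (size s1 + (size s2 + (size s3).+1).+1)%N = n.
  by rewrite -sn es size_cat /= size_cat.
have lt1 : (size s1 < n)%N by rewrite -sz -addSnnS leq_addr.
have lt2 : (size s1 + (size s2).+1 < n)%N.
  by rewrite -sz addnS -addnS ltn_add2l addnS !ltnS leq_addr.
have ne : Ordinal lt2 != Ordinal lt1.
  by apply/eqP => /(congr1 val) /= /eqP; rewrite -[X in _ == X]addn0 eqn_add2l.
rewrite (bigD1 (Ordinal lt1)) //= (bigD1 (Ordinal lt2)) //=.
rewrite [X in _ + (_ + X)]big1 ?addr0 => [|i /andP[n1 n2]]; last first.
  have [_ ->] := Kalt (nth 0 s i); rewrite ?scaler0 // ?size_omit ?sn //.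
  have [lt|gt|eq] := ltngtP i (size s1).
  - rewrite es omit_lt // cat_uniq; apply/negP => /and3P[_ _] /=.
    by rewrite mem_cat inE eqxx orbT.
  - have [j ej] : exists j, nat_of_ord i = ((size s1).+1 + j)%N.
      by exists (i - (size s1).+1)%N; rewrite subnKC.
    rewrite es ej omit_gt cat_uniq.
    apply/negP => /and3P[_ _] /= /andP[/negP + _]; apply.
    have [lt'|gt'|eq'] := ltngtP j (size s2).
    + by rewrite omit_lt // mem_cat inE eqxx orbT.
    + have [l el] : exists l, j = ((size s2).+1 + l)%N.
        by exists (j - (size s2).+1)%N; rewrite subnKC.
      by rewrite el omit_gt mem_cat inE eqxx orbT.
    + by case/eqP: n2; apply: val_inj => /=; rewrite ej eq' addSnnS.
  - by case/eqP: n1; apply: val_inj.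
have e1 : nth 0 s (size s1) = z by rewrite es nth_cat ltnn subnn.
have e2 : nth 0 s (size s1 + (size s2).+1) = z.
  by rewrite es nth_cat ltnNge leq_addr /= addKn /= nth_cat ltnn subnn.
rewrite e1 e2 es omit_ge addnS -addSn omit_gt omit_ge.
rewrite (swap_move (alternating_swap (Kalt z))); last first.
  by rewrite -sz !addnS /= addnA.
rewrite addSn exprS exprD mulN1r scaleNr scalerA.
by rewrite subrr.
Qed.

End ExteriorPower.

Section Identification.
Variables (k : fieldType) (g : lieAlgType k).

Definition red_coproduct (u : uea g) : cochain g 2 :=
  coproduct u - tens 2 [:: u; 1] - tens 2 [:: 1; u].

Lemma differential_tens n (s : seq (uea g)) : size s = n ->
  differential (tens n s : cochain g n) =
  \sum_(i < n) (-1) ^+ i.+1 *: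
    tsplice n.+1 (take i s) (drop i.+1 s) (red_coproduct (nth 0 s i)).
Proof.
move=> sn; pose T j : cochain g n.+1 := tens n.+1 (take j s ++ 1 :: drop j s).
rewrite /differential !tsplice_tens // cats0 /=.
rewrite -[tens n.+1 (1 :: s)]/(tens n.+1 (take 0 (1 :: s) ++ 1 :: s)).
have -> : tens n.+1 (1 :: s) = T 0 by rewrite /T take0 drop0.
have -> : tens n.+1 (s ++ [:: 1]) = T n by rewrite /T -sn take_size drop_size.
rewrite (eq_bigr (fun i : 'I_n => (-1) ^+ i.+1 *:
    tsplice n.+1 (take i s) (drop i.+1 s) (red_coproduct (nth 0 s i)) +
    ((-1) ^+ i.+1 *: T i.+1 - (-1) ^+ i *: T i))); last first.
  move=> i _; rewrite tslot_tens //=.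
  have -> : coproduct (nth 0 s i) = red_coproduct (nth 0 s i)
      + tens 2 [:: nth 0 s i; 1] + tens 2 [:: 1; nth 0 s i].
    by rewrite /red_coproduct -addrA addrACA addNr addr0 subrK.
  have LD u v : tsplice n.+1 (take i s) (drop i.+1 s) (u + v) =
      tsplice n.+1 (take i s) (drop i.+1 s) u +
      tsplice n.+1 (take i s) (drop i.+1 s) v by apply: linearD.
  rewrite !{}LD !tsplice_tens //= !scalerDr -addrA; congr (_ + _).
  rewrite exprS mulN1r !scaleNr /T; congr (- (_ *: tens _ _) - _ *: tens _ _).
    by rewrite (take_nth 0) ?sn // cat_rcons.
  by rewrite [drop i s](drop_nth 0) ?sn.
rewrite big_split /= -(big_mkord xpredT (fun i =>
  (-1) ^+ i.+1 *: T i.+1 - (-1) ^+ i *: T i)) telescope_sumr //.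
rewrite expr0 scale1r [in X in _ + X]exprS mulN1r scaleNr.
by rewrite [LHS](AC ((1*(1*2))*1) (2*(1*4)*(3*5))) /= !subrr !addr0.
Qed.

Lemma red_coproduct_iota x : red_coproduct (iota x) = 0.
Proof.
rewrite /red_coproduct /coproduct ulift_iota; last 2 first.
- exact: primitive2_linear.
- exact: primitive2_lie.
by rewrite /primitive2 addrAC addrK subrr.
Qed.

Lemma red_coproduct_mul x y : red_coproduct (iota x * iota y) =
  tens 2 [:: iota x; iota y] + tens 2 [:: iota y; iota x].
Proof.
have cE z : coproduct (iota z) = primitive2 z.
  by apply: ulift_iota; [apply: primitive2_linear|apply: primitive2_lie].
rewrite /red_coproduct rmorphM /= !cE /primitive2.
rewrite !mulrDl !mulrDr !cochain_mul_tens //= /zipmul /= !(mul1r, mulr1).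
by rewrite [LHS](AC ((2*2)*1*1) ((2*3)*(1*5)*(4*6))) /= !subrr !addr0.
Qed.

Lemma iota_cocycle n (s : seq g) : size s = n ->
  cocycle (tens n (map (@iota k g) s) : cochain g n).
Proof.
move=> sn; apply/eqP; rewrite differential_tens ?size_map // big1 // => i _.
by rewrite (nth_map 0) ?sn // red_coproduct_iota linear0 scaler0.
Qed.

(* The linear map x_1 /\ ... /\ x_n |-> [x_1 (x) ... (x) x_n]; see
   ext_cohomology_wedge. *)
Definition ext_cohomology n : ext g n -> cohomology g n :=
  elift (fun s => hclass (tens n (map (@iota k g) s) : cochain g n)).

End Identification.

Section IdentificationTheory.
Variables (k : fieldType) (g : lieAlgType k).
Hypothesis k0 : [pchar k] =i pred0.

Let cls n s := hclass (tens n (map (@iota k g) s) : cochain g n).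

Let cls_swap n s x y t : (size s + size t).+2 = n ->
  cls n (s ++ x :: y :: t) = - cls n (s ++ y :: x :: t).
Proof.
case: n => // n [stn].
pose i := @iota k g; pose p := map i s ++ (i x * i y) :: map i t.
have sp : size p = n by rewrite size_cat /= !size_map addnS.
have sz z w : size (s ++ z :: w :: t) = n.+1 by rewrite size_cat /= !addnS stn.
have dp : differential ((-1) ^+ (size s).+1 *: (tens n p : cochain g n)) =
    1 *: (tens n.+1 (map i (s ++ x :: y :: t)) : cochain g n.+1)
    + tens n.+1 (map i (s ++ y :: x :: t)).
  have lt : (size s < n)%N by rewrite -stn ltnS leq_addr.
  rewrite linearZ /= differential_tens // (bigD1 (Ordinal lt)) //=.
  rewrite big1 ?addr0 => [|j nj]; last first.
    suff [z ->] : exists z, nth 0 p j = i z.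
      by rewrite red_coproduct_iota linear0 scaler0.
    rewrite /p nth_cat size_map; case: ltngtP => [lj|gj|ej].
    - by exists (nth 0 s j); rewrite (nth_map 0).
    - have [l el] : exists l, nat_of_ord j = ((size s).+1 + l)%N.
        by exists (j - (size s).+1)%N; rewrite subnKC.
      rewrite el addSn -addnS addKn /=.
      exists (nth 0 t l); rewrite (nth_map 0) //.
      have := ltn_ord j.
      by rewrite el -[X in (_ < X)%N]stn addSn ltnS ltn_add2l.
    - by case/eqP: nj; apply: val_inj.
  rewrite scalerA -exprD addnn -mul2n exprM sqrrN !expr1n !scale1r.
  have -> : nth 0 p (size s) = i x * i y.
    by rewrite /p nth_cat size_map ltnn subnn.
  have -> : take (size s) p = map i s by rewrite /p take_size_cat ?size_map.
  have -> : drop (size s).+1 p = map i t.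
    rewrite /p -cat_rcons -(size_map i s) -(size_rcons (map i s) (i x * i y)).
    by rewrite drop_size_cat.
  rewrite red_coproduct_mul.
  have LD u v : tsplice n.+1 (map i s) (map i t) (u + v) =
      tsplice n.+1 (map i s) (map i t) u +
      tsplice n.+1 (map i s) (map i t) v by apply: linearD.
  by rewrite LD !tsplice_tens //= !map_cat.
apply/eqP; rewrite -addr_eq0 -[X in X + _]scale1r /cls.
rewrite -hclass_lin; last 2 first.
- exact: iota_cocycle.
- exact: iota_cocycle.
have z0 : cocycle (0 : cochain g n.+1) by apply/eqP; rewrite linear0.
have hz : hclass (0 : cochain g n.+1) = 0.
  by have := hclass_lin (-1) z0 z0; rewrite scaler0 addr0 scaleN1r addNr.
rewrite -hz; apply/eqP/hclassE => //.
  have [_ h] := @cocycle_submod k g n.+1.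
  by have := h 1 _ _ (iota_cocycle (sz x y)) (iota_cocycle (sz y x)).
by rewrite subr0 -dp; exists ((-1) ^+ (size s).+1 *: (tens n p : cochain g n)).
Qed.

Lemma ext_cohomology_alternating n : alternating n (cls n).
Proof.
split=> [c s x y t stn|s sn /not_uniqP[s1 [x [s2 [s3 es]]]]].
  have sz z : size (s ++ z :: t) = n by rewrite size_cat /= addnS.
  rewrite /cls !map_cat !map_cons linearP /= tens_lin.
  have := iota_cocycle (sz x); have := iota_cocycle (sz y).
  by rewrite !map_cat !map_cons => zy zx; rewrite -hclass_lin.
have e : (size s1 + (size s2 + (size s3).+1).+1)%N = n.
  by rewrite -sn es size_cat /= size_cat.
have two : 2%:R != 0 :> k.
  apply/eqP => h; have := k0 2%N; rewrite !inE /= h eqxx.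
  by [].
have xx : cls n (s1 ++ x :: x :: s2 ++ s3) = 0.
  have exx : (size s1 + size (s2 ++ s3)).+2 = n by rewrite size_cat -e !addnS.
  have /eqP := cls_swap x x exx.
  rewrite -addr_eq0 -mulr2n -scaler_nat scaler_eq0 (negPf two) /=.
  by move/eqP.
rewrite es -cat_rcons (swap_move (@cls_swap n)) ?cat_rcons ?xx ?scaler0 //.
by rewrite size_rcons -e !addnS !addSn addnA.
Qed.

Lemma ext_cohomology_wedge n s : size s = n ->
  ext_cohomology (wedge n s) =
  hclass (tens n (map (@iota k g) s) : cochain g n).
Proof. exact/elift_wedge/ext_cohomology_alternating. Qed.

Lemma ext_cohomology_is_linear n : linear (@ext_cohomology k g n).
Proof. exact/elift_is_linear/ext_cohomology_alternating. Qed.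

End IdentificationTheory.

Section Schouten.
Variables (k : fieldType) (g : lieAlgType k).

Definition schouten_term m n (x y : seq g) i j : ext g (m + n).-1 :=
  (-1) ^+ (i + j) *:
    wedge _ (lie (nth 0 x i) (nth 0 y j) ::
             take i x ++ drop i.+1 x ++ take j y ++ drop j.+1 y).

(* The bilinear extension of the formula on products of vectors, see
   schouten_wedge. The indices i, j start at 0, which does not change the parity
   of i + j. *)
Definition schouten m n (u : ext g m) (v : ext g n) : ext g (m + n).-1 :=
  elift (fun x => elift (fun y =>
    \sum_(i < m) \sum_(j < n) schouten_term m n x y i j) v) u.

Let termE m n (x y : seq g) i j : schouten_term m n x y i j =
  (-1) ^+ i *: ((-1) ^+ j *: wedge _ (lie (nth 0 x i) (nth 0 y j) ::
    omit i x ++ omit j y)).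
Proof. by rewrite /schouten_term /omit scalerA -exprD !catA. Qed.

Let wedge_lin N c s x y t :
  wedge N (s ++ (c *: x + y) :: t) =
  c *: wedge N (s ++ x :: t) + wedge N (s ++ y :: t) :> ext g N.
Proof. exact: mgen_lin. Qed.

Let wedge_null N (s : seq g) : ~~ uniq s -> wedge N s = 0.
Proof. by move=> us; apply: mgen_null; rewrite us orbT. Qed.

Let inner_alternating m n (x : seq g) : alternating n (fun y =>
  \sum_(i < m) \sum_(j < n) schouten_term m n x y i j).
Proof.
have alt : alternating n (fun y => \sum_(j < n) (-1) ^+ j *:
    (\sum_(i < m) (-1) ^+ i *: wedge (m + n).-1
      (lie (nth 0 x i) (nth 0 y j) :: omit i x ++ omit j y))).
  apply: (@contraction_alternating _ _ _ n (fun z r =>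
    \sum_(i < m) (-1) ^+ i *: wedge _ (lie (nth 0 x i) z :: omit i x ++ r))).
    move=> r _ c z w; rewrite scaler_sumr -big_split; apply: eq_bigr => i _ /=.
    rewrite lie_linr (wedge_lin _ _ [::]) /= scalerDr !scalerA.
    by rewrite (mulrC c).
  move=> z; split=> [c s v w t _|s _ us].
    rewrite scaler_sumr -big_split; apply: eq_bigr => i _ /=.
    rewrite !catA -!cat_cons wedge_lin /= scalerDr !scalerA.
    by rewrite (mulrC c).
  rewrite big1 // => i _; rewrite wedge_null ?scaler0 //=.
  by rewrite cat_uniq (negPf us) !andbF.
have E y : \sum_(i < m) \sum_(j < n) schouten_term m n x y i j =
    \sum_(j < n) (-1) ^+ j *: (\sum_(i < m) (-1) ^+ i *: wedge (m + n).-1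
      (lie (nth 0 x i) (nth 0 y j) :: omit i x ++ omit j y)).
  rewrite exchange_big; apply: eq_bigr => j _; rewrite scaler_sumr.
  by apply: eq_bigr => i _; rewrite termE !scalerA mulrC.
split=> [c s v w t e|s e us]; rewrite !E; first exact: (proj1 alt).
exact: (proj2 alt).
Qed.

Let outer_alternating m n (v : ext g n) : alternating m (fun x =>
  elift (fun y => \sum_(i < m) \sum_(j < n) schouten_term m n x y i j) v).
Proof.
have lin x := elift_is_linear (inner_alternating m n x).
elim/ext_ind: v => [|c u v [IHu IHu'] [IHv IHv']|y yn].
- have e x : elift (fun y => \sum_(i < m) \sum_(j < n)
      schouten_term m n x y i j) (0 : ext g n) = 0.
    by have := lin x (-1) 0 0; rewrite scaler0 addr0 scaleN1r addNr.
  by split=> [d s z w t _|s _ _]; rewrite !e ?scaler0 ?addr0.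
- split=> [d s z w t e|s e us]; rewrite !lin.
    by rewrite IHu // IHv // !scalerDr !scalerA (mulrC d) addrACA.
  by rewrite IHu' // IHv' // scaler0 addr0.
have alt : alternating m (fun x => \sum_(i < m) (-1) ^+ i *:
    (\sum_(j < n) (-1) ^+ j *: wedge (m + n).-1
      (lie (nth 0 x i) (nth 0 y j) :: omit i x ++ omit j y))).
  apply: (@contraction_alternating _ _ _ m (fun z r =>
    \sum_(j < n) (-1) ^+ j *: wedge _ (lie z (nth 0 y j) :: r ++ omit j y))).
    move=> r _ c z w; rewrite scaler_sumr -big_split; apply: eq_bigr => i _ /=.
    rewrite lie_linl (wedge_lin _ _ [::]) /= scalerDr !scalerA.
    by rewrite (mulrC c).
  move=> z; split=> [c s v w t _|s _ us].
    rewrite scaler_sumr -big_split; apply: eq_bigr => i _ /=.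
    rewrite -!catA !cat_cons -!cat_cons wedge_lin /= scalerDr !scalerA.
    by rewrite (mulrC c).
  rewrite big1 // => i _; rewrite wedge_null ?scaler0 //=.
  by rewrite cat_uniq (negPf us) /= !andbF.
have E x : elift (fun y => \sum_(i < m) \sum_(j < n) schouten_term m n x y i j)
      (wedge n y) = \sum_(i < m) (-1) ^+ i *: (\sum_(j < n) (-1) ^+ j *:
    wedge (m + n).-1 (lie (nth 0 x i) (nth 0 y j) :: omit i x ++ omit j y)).
  rewrite (elift_wedge (inner_alternating m n x)) //; apply: eq_bigr => i _.
  by rewrite scaler_sumr; apply: eq_bigr => j _; rewrite termE.
split=> [c s v w t e|s e us]; rewrite !E; first exact: (proj1 alt).
exact: (proj2 alt).
Qed.

Lemma schouten_wedge m n (x y : seq g) : size x = m -> size y = n ->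
  schouten (wedge m x) (wedge n y) =
  \sum_(i < m) \sum_(j < n) schouten_term m n x y i j.
Proof.
move=> xm yn; rewrite /schouten (elift_wedge (outer_alternating m _)) //.
exact: elift_wedge (inner_alternating m n x) _.
Qed.

Lemma schouten_linl m n (v : ext g n) : linear ((@schouten m n)^~ v).
Proof. exact: elift_is_linear (outer_alternating m v). Qed.

Lemma schouten_linr m n (u : ext g m) : linear (@schouten m n u).
Proof.
move=> c v w; elim/ext_ind: u => [|d u u' IH IH'|x xm].
- have l0 t : schouten (0 : ext g m) t = 0 :> ext g (m + n).-1.
    by have := schouten_linl t (-1) (0 : ext g m) 0;
      rewrite scaler0 addr0 scaleN1r addNr.
  by rewrite !l0 scaler0 addr0.
- rewrite !(schouten_linl _ d) IH IH' !scalerDr !scalerA (mulrC c).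
  by rewrite addrACA.
rewrite /schouten !(elift_wedge (outer_alternating m _)) //.
exact: elift_is_linear (inner_alternating m n x) _ _ _.
Qed.

End Schouten.

(* Main.v *)
From HB Require Import structures.
Require Import Defs.
From mathcomp Require Import all_boot all_order all_algebra.
From mathcomp Require Import zify.

Set Implicit Arguments.
Unset Strict Implicit.
Unset Printing Implicit Defensive.

Import GRing.Theory.
Local Open Scope ring_scope.

(** The cochains U(g)^n form a non-symmetric operad: the partial composition
    circ_at puts b into the i-th factor of a, after spreading that factor over
    the factors of b by the iterated coproduct. The two operad axioms,
    circ_at_seq and circ_at_par, hold because the coproduct is multiplicative
    and coassociative. The unit mu of U(g)^2 is an associative multiplication in
    this operad, and the differential is made of compositions with mu
    (differentialE). Gerstenhaber's argument then applies: in the differential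
    of a circle product a o b, every composition cancels against da o b or
    a o db, except the two cup products of a and b (differential_circ). They
    disappear from the antisymmetrization, so the differential is a derivation
    of the bracket and the bracket descends to cohomology.

    For the comparison with the Schouten bracket take tensors X = x_1 ... x_m
    and Y = y_1 ... y_n of elements of g. If X = z X', the circle product X o Y
    is the sum, up to sign, of (z.Y) X' and of z (X' o Y), where z acts
    diagonally (circ_cons). For Y o X the analogous splitting into (Y o z) X'
    and z (Y o X') only holds up to a coboundary (circ_cons_coboundary). By
    induction on Y = w Y', the homotopy is the tensor (wz) (Y' o X'), where wz
    is a product in U(g): the failure of wz to be primitive produces
    w z (Y' o X') + z w (Y' o X'), while the differential of Y' o X' is, up to
    sign, the graded commutator of Y' and X' computed before. Subtracting the
    two splittings, the products x_i y_j and y_j x_i combine into Lie brackets,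
    and {X, Y} is cohomologous to the signed sum of the tensors
      x_1 .. x_(i-1) y_1 .. y_(j-1) [x_i, y_j] y_(j+1) .. y_n x_(i+1) .. x_m
    (gbracket_tens). As the class of a tensor of elements of g is alternating in
    its entries, moving [x_i, y_j] to the front, and then the x_l with l > i
    before the y's, gives the signs of the Schouten bracket
    (wedge_bracket_seq). *)

(** * Sums and signs *)

Section Sums.
Variable V : nmodType.

(** The factors of an insertion: if an operation with n inputs is put into input
    i of an operation with m inputs, then the N inputs of the result are those
    before i, the n new ones, and those after i, shifted by n - 1. *)
Lemma sum_block m n N i (f : nat -> V) : (i < m)%N -> (m + n)%N = N.+1 ->
  \sum_(j < N) f j = \sum_(p < m | (p < i)%N) f p +
    (\sum_(r < n) f (i + r)%N + \sum_(p < m | (i < p)%N) f (p + n).-1).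
Proof.
move=> im e.
have shift p q (h : nat -> V) :
    \sum_(p <= j < q) h j = \sum_(0 <= r < q - p) h (r + p)%N.
  by rewrite -{1}[p]add0n big_addn.
rewrite -(big_mkord xpredT f) (big_cat_nat (n := i)) //=; last by lia.
rewrite (big_cat_nat (m := i) (n := (i + n)%N)) /=; [|by lia..].
rewrite big_mkord (big_ord_widen m) ?(ltnW im) //; congr (_ + (_ + _)).
  by rewrite shift addKn big_mkord; apply: eq_bigr => r _; rewrite addnC.
have := big_geq_mkord i.+1 m xpredT (fun p => f (p + n).-1) => /= <-.
rewrite [LHS]shift [RHS]shift.
have -> : (N - (i + n))%N = (m - i.+1)%N by lia.
by apply: eq_bigr => r _; congr f; lia.
Qed.
End Sums.

Section Signs.
Variable R : pzRingType.

Lemma signr_parity i j : odd i = odd j -> (-1) ^+ i = (-1) ^+ j :> R.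
Proof. by move=> e; rewrite -[LHS]signr_odd e signr_odd. Qed.

Lemma signr_parityN i j : odd i = ~~ odd j -> (-1) ^+ i + (-1) ^+ j = 0 :> R.
Proof.
by move=> e; rewrite -[X in X + _]signr_odd e signrN signr_odd addNr.
Qed.
End Signs.

(** Proves equalities of signs, and the vanishing of sums of two signs, by
    comparing the parities of polynomial exponents. *)
Ltac parity :=
  first [apply: signr_parity | apply: signr_parityN]; rewrite ?mulSn;
  rewrite ?(oddD, oddM, oddS, negbK) /= ?(oddD, oddM, oddS, negbK);
  repeat match goal with |- context [odd ?n] => case: (odd n) end; by [].

Section SignedSums.
Variables (k : pzRingType) (V : lmodType k).

(** The signs and indices of differential_circ, separated from the operad.
    There, with mu the multiplication, m and n the degrees of a and b,
    - A q is (mu o_1 a) o_q b and Z q is (mu o_0 a) o_q b,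
    - K p q is (a o_p mu) o_q b and G i j is (a o_i b) o_j mu,
    - B i r is a o_i (b o_r mu), B0 i is a o_i (mu o_0 b) and B1 i is
      a o_i (mu o_1 b),
    so that the hypotheses are instances of the operad axioms. The terms G i j
    with j outside the block of b match the K p q with q different from p and
    p + 1; the terms K p p and K p p.+1 cancel the outer faces of b; A 0 and Z m
    are left, the two cup products. *)
Lemma circ_sum_identity m n N (A Z B0 B1 : nat -> V) (K G B : nat -> nat -> V) :
  (m + n)%N = N.+1 ->
  (forall i p, (p < i)%N -> (i < m)%N -> G i p = K p i.+1) ->
  (forall i r, (i < m)%N -> (r < n)%N -> G i (i + r)%N = B i r) ->
  (forall i p, (i < p)%N -> (p < m)%N -> G i (p + n).-1 = K p i) ->
  (forall p, (p < m)%N -> K p p = B0 p) ->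
  (forall p, (p < m)%N -> K p p.+1 = B1 p) ->
  let s i := (-1) ^+ (n.+1 * i) : k in
  \sum_(i < m) s (m - i.+1)%N *: A i.+1
    + \sum_(i < m) s (m - i.+1)%N *: (\sum_(j < N) (-1) ^+ j.+1 *: G i j)
    + (-1) ^+ N.+1 *: (\sum_(i < m) s (m - i.+1)%N *: Z i) =
  \sum_(q < m.+1) s (m.+1 - q.+1)%N *: (A q
    + \sum_(p < m) (-1) ^+ p.+1 *: K p q + (-1) ^+ m.+1 *: Z q)
  + (-1) ^+ m.+1 *: (\sum_(i < m) (-1) ^+ (n.+2 * (m - i.+1)) *: (B1 i
    + \sum_(r < n) (-1) ^+ r.+1 *: B i r + (-1) ^+ n.+1 *: B0 i))
  - s m *: A 0%N + (-1) ^+ m *: Z m.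
Proof.
move=> eN GK GB GK' KB0 KB1 s.
have mid : \sum_(i < m) s (m - i.+1)%N *: (\sum_(j < N) (-1) ^+ j.+1 *: G i j) =
    \sum_(q < m.+1) s (m - q)%N *: (\sum_(p < m) (-1) ^+ p.+1 *: K p q)
    + (-1) ^+ m.+1 *: (\sum_(i < m) (-1) ^+ (n.+2 * (m - i.+1)) *: (B1 i
    + \sum_(r < n) (-1) ^+ r.+1 *: B i r + (-1) ^+ n.+1 *: B0 i)).
  under [X in X + _]eq_bigr => q _ do rewrite scaler_sumr.
  rewrite [X in X + _]exchange_big /=.
  rewrite [X in _ = X + _](eq_bigr (fun p : 'I_m =>
     \sum_(q < m | (q < p)%N) (s (m - q)%N * (-1) ^+ p.+1) *: K p q
     + (\sum_(r < 2) (s (m - (p + r))%N * (-1) ^+ p.+1) *: K p (p + r)%N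
     + \sum_(q < m | (p < q)%N) (s (m - q.+1)%N * (-1) ^+ p.+1) *: K p q.+1)));
    last first.
    move=> p _; under eq_bigr => q _ do rewrite scalerA.
    rewrite (@sum_block _ m 2 m.+1 p (fun q => (s (m - q)%N * (-1) ^+ p.+1) *:
      K p q)) ?ltn_ord ?addn2 //.
    by congr (_ + (_ + _)); apply: eq_bigr => q _; rewrite addn2.
  rewrite [LHS](eq_bigr (fun i : 'I_m =>
     \sum_(p < m | (p < i)%N) (s (m - i.+1)%N * (-1) ^+ p.+1) *: K p i.+1
     + (\sum_(r < n) (s (m - i.+1)%N * (-1) ^+ (i + r).+1) *: B i r
     + \sum_(p < m | (i < p)%N) (s (m - i)%N * (-1) ^+ p.+1) *: K p i)));
    last first.
    move=> i _; have lt := ltn_ord i.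
    rewrite scaler_sumr; under eq_bigr => j _ do rewrite scalerA.
    rewrite (@sum_block _ m n N i
      (fun j => (s (m - i.+1)%N * (-1) ^+ j.+1) *: G i j)) //.
    congr (_ + (_ + _)); apply: eq_bigr => j ij; [by rewrite GK|by rewrite GB|].
    rewrite GK' //; congr (_ *: _).
    have -> : (m - i)%N = (m - i.+1).+1 by lia.
    have -> : (j + n).-1.+1 = (j + n)%N by lia.
    by rewrite /s -!exprD; parity.
  rewrite !big_split /= scaler_sumr.
  rewrite [X in X + _ = _](exchange_big_dep predT) //=.
  rewrite [X in _ + (_ + X) = _](exchange_big_dep predT) //=.
  rewrite [LHS](AC (1*2) (3*1*2)) [RHS](AC ((1*2)*1) ((1*3)*(2*4))) /=.
  congr (_ + _).
  (* What remains are, for each i, the faces of b. *)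
  rewrite -big_split; apply: eq_bigr => i _ /=.
  have lt := ltn_ord i.
  rewrite big_ord_recl big_ord1 /= addn0 addn1 KB0 // KB1 //.
  have -> : (m - i)%N = (m - i.+1).+1 by lia.
  have -> : (-1) ^+ m.+1 = (-1) ^+ (m - i.+1 + i).+2 :> k.
    by congr (_ ^+ _); lia.
  rewrite scalerA !scalerDr !scaler_sumr.
  rewrite [RHS](AC (2*3) ((1*5)*(2*3)*4)) /=.
  rewrite -!scalerDl !scalerA.
  rewrite -scalerDl /s -!exprD.
  have -> : (-1) ^+ (n.+1 * (m - i.+1).+1 + i.+1) +
      (-1) ^+ ((m - i.+1 + i).+2 + n.+2 * (m - i.+1) + n.+1) = 0 :> k.
    by parity.
  have -> : (-1) ^+ (n.+1 * (m - i.+1) + i.+1) +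
      (-1) ^+ ((m - i.+1 + i).+2 + n.+2 * (m - i.+1)) = 0 :> k.
    by parity.
  rewrite !scale0r !add0r; apply: eq_bigr => r _.
  by rewrite scalerA -!exprD; congr (_ *: _); parity.
under [in RHS]eq_bigr => q _ do rewrite subSS !scalerDr.
rewrite !big_split /= mid.
rewrite [X in _ = X + _ + _ + _ - _ + _]big_ord_recl subn0.
rewrite [X in _ = _ + X + _ - _ + _]big_ord_recr subnn.
rewrite /= /s muln0 scale1r -/s.
rewrite [RHS](AC (2*1*2*1*1*1) ((1*7)*((2*3)*(6*4))*(5*8))) /=.
have -> : (-1) ^+ m.+1 *: Z m + (-1) ^+ m *: Z m = 0.
  by rewrite exprS mulN1r scaleNr addNr.
rewrite subrr add0r addr0.
rewrite [LHS](AC (1*2*1) (1*2*(3*4))) /=; congr (_ + _ + (_ + _)).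
rewrite scaler_sumr; apply: eq_bigr => i _; have lt := ltn_ord i.
rewrite !scalerA; congr (_ *: _).
have -> : (m - i)%N = (m - i.+1).+1 by lia.
have -> : N.+1 = (i + n + (m - i.+1)).+1 by lia.
have -> : (-1) ^+ m.+1 = (-1) ^+ (m - i.+1 + i).+2 :> k.
  by congr (_ ^+ _); lia.
by rewrite /s -!exprD; parity.
Qed.
End SignedSums.

(** * Tensors and the iterated coproduct *)

Lemma nth_split (T : Type) i n (s : seq T) : size s = n -> (i < n)%N ->
  exists s1 u s2, [/\ s = s1 ++ u :: s2, size s1 = i & size s2 = (n - i.+1)%N].
Proof.
move=> <-; case: s => // x s lt; set t := x :: s in lt *.
exists (take i t), (nth x t i), (drop i.+1 t).
by rewrite -drop_nth // cat_take_drop size_takel ?(ltnW lt) // size_drop.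
Qed.

Section TensorCalculus.
Variables (k : fieldType) (g : lieAlgType k).
Local Notation U := (uea g).
Local Notation C := (cochain g).
Implicit Types l r s t : seq U.

Lemma tone_tens n : (1 : C n) = tens n (nseq n 1).
Proof. by []. Qed.

Lemma tsplice_nil n (w : C n) : tsplice n [::] [::] w = w.
Proof.
elim/tpow_ind: w => [c u v IHu IHv|s sn]; first by rewrite linearP /= IHu IHv.
by rewrite tsplice_tens //= cats0.
Qed.

Lemma tsplice_tsplice n M N l l' r r' (w : C n) :
  (size l' + n + size r')%N = M ->
  tsplice N l r (tsplice M l' r' w : C M) = tsplice N (l ++ l') (r' ++ r) w.
Proof.
move=> eM; elim/tpow_ind: w => [c u v IHu IHv|s sn].
  by rewrite !linearP /= IHu IHv.
by rewrite !tsplice_tens ?size_cat ?sn ?addnA // -!catA.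
Qed.

Lemma tsplice_mul n N l l' r r' (v w : C n) :
  size l = size l' -> size r = size r' -> (size l + n + size r)%N = N ->
  (tsplice N l r v : C N) * tsplice N l' r' w =
  tsplice N (zipmul l l') (zipmul r r') (v * w).
Proof.
move=> el er eN; elim/tpow_ind: v => [c u v IHu IHv|s sn].
  by rewrite linearP /= mulrDl -scalerAl IHu IHv mulrDl -scalerAl linearP.
elim/tpow_ind: w => [c u v IHu IHv|t tn].
  by rewrite linearP /= mulrDr -scalerAr IHu IHv mulrDr -scalerAr linearP.
rewrite cochain_mul_tens // !tsplice_tens ?size_zipmul ?tn //.
rewrite cochain_mul_tens ?size_cat ?sn ?tn ?addnA -?el -?er //.
by rewrite !zipmul_cat // sn tn.
Qed.

Lemma tsplice_one n N i j : (i + n + j)%N = N ->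
  tsplice N (nseq i 1) (nseq j 1) (1 : C n) = (1 : C N).
Proof.
by move=> <-; rewrite !tone_tens tsplice_tens ?size_nseq // -!nseqD addnA.
Qed.

Lemma tslot_tens_cat m N i q (F : {linear U -> C q}) s1 u s2 : size s1 = i ->
  (i + size s2).+1 = m ->
  tslot N i F (tens m (s1 ++ u :: s2)) = tsplice N s1 s2 (F u).
Proof.
move=> <- em; rewrite tslot_tens ?size_cat ?addnS //.
rewrite take_size_cat // nth_cat ltnn subnn.
by rewrite -cat_rcons -(size_rcons s1 u) drop_size_cat.
Qed.

Lemma tslot_one n N p q (F : {linear U -> C q}) :
  F 1 = 1 -> (p < n)%N -> (n + q)%N = N.+1 -> tslot N p F (1 : C n) = (1 : C N).
Proof.
move=> F1 pn e; rewrite tone_tens tslot_tens ?size_nseq // nth_nseq pn F1.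
rewrite take_nseq ?(ltnW pn) // drop_nseq tsplice_one //.
by lia.
Qed.

Lemma tslot_mul n N p q (F : {linear U -> C q}) (v w : C n) :
  {morph F : x y / x * y} -> (p < n)%N -> (n + q)%N = N.+1 ->
  tslot N p F (v * w) = (tslot N p F v : C N) * tslot N p F w.
Proof.
move=> FM pn e; elim/tpow_ind: v => [c u v IHu IHv|s sn].
  by rewrite mulrDl -scalerAl !linearP /= mulrDl -scalerAl IHu IHv.
elim/tpow_ind: w => [c u v IHu IHv|t tn].
  by rewrite mulrDr -scalerAr !linearP /= mulrDr -scalerAr IHu IHv.
have [s1 [x [s2 [-> s1p s2p]]]] := nth_split sn pn.
have [t1 [y [t2 [-> t1p t2p]]]] := nth_split tn pn.
have sz r1 z r2 : size r1 = p -> size r2 = (n - p.+1)%N ->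
    size (r1 ++ z :: r2 : seq U) = n.
  by rewrite size_cat /= => -> ->; lia.
rewrite cochain_mul_tens ?sz // zipmul_cat ?s1p // zipmul_cons.
rewrite !tslot_tens_cat ?size_zipmul ?s1p ?s2p ?t2p //; try lia.
by rewrite FM tsplice_mul ?s1p ?s2p //; lia.
Qed.

(** For n = 0 this is the counit, for n = 1 the identity; then each step applies
    the coproduct to one factor, which is multiplicative by tslot_mul. *)
Let iter_coproduct_mor n : linear (@iter_coproduct k g n) *
  monoid_morphism (@iter_coproduct k g n).
Proof.
elim: n => [|[_|m [lin [one mul]]]].
- split=> [c u v|]; first by rewrite /= linearP scalerDl scalerA.
  split=> [|u v] /=; first by rewrite rmorph1 scale1r.
  by rewrite rmorphM -scalerAl -scalerAr mulr1 scalerA.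
- split=> [c u v|]; first exact: (@tens_lin _ _ 1 c [::] u v [::]).
  by split=> // u v /=; rewrite cochain_mul_tens.
split=> [c u v|].
  by rewrite [LHS]/= -[X in tslot _ _ _ X]/(iter_coproduct m.+1 _) lin linearP.
have e : (m.+1 + 2)%N = m.+3 by rewrite addn2.
split=> [|u v]; rewrite [LHS]/= -[X in tslot _ _ _ X]/(iter_coproduct m.+1 _).
  by rewrite one tslot_one //; apply: rmorph1.
by rewrite mul tslot_mul //; apply: rmorphM.
Qed.

HB.instance Definition _ n := GRing.isLinear.Build k U (C n) *:%R
  (@iter_coproduct k g n) (iter_coproduct_mor n).1.
HB.instance Definition _ n := GRing.isMonoidMorphism.Build U (C n)
  (@iter_coproduct k g n) (iter_coproduct_mor n).2.
End TensorCalculus.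

(** * The operad of cochains *)

Section Operad.
Variables (k : fieldType) (g : lieAlgType k).
Local Notation U := (uea g).
Local Notation C := (cochain g).
Local Notation iota := (@Defs.iota k g).
Implicit Types l r s t : seq U.

Lemma circ_at_linl m n N i (b : C n) : linear (fun a : C m => circ_at N i a b).
Proof. by move=> c a a'; rewrite /circ_at linearP mulrDl -scalerAl. Qed.

Lemma circ_at_is_linear m n N i (a : C m) : linear (@circ_at k g m n N i a).
Proof. by move=> c b b'; rewrite /circ_at linearP /= mulrDr -scalerAr. Qed.
HB.instance Definition _ m n N i (a : C m) := GRing.isLinear.Build k (C n) (C N)
  *:%R (@circ_at k g m n N i a) (circ_at_is_linear N i a).

Lemma iter_coproduct2 (u : U) : iter_coproduct 2 u = coproduct u.
Proof. by rewrite /= tslot_tens //= tsplice_nil. Qed.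

Lemma circ_at_tens m n N i s1 u s2 (b : C n) : size s1 = i ->
  (i + size s2).+1 = m -> (m + n)%N = N.+1 ->
  circ_at N i (tens m (s1 ++ u :: s2)) b =
  tsplice N s1 s2 (iter_coproduct n u * b).
Proof.
move=> <- em eN; rewrite /circ_at tslot_tens_cat //.
have -> : (m - (size s1).+1)%N = size s2 by lia.
by rewrite tsplice_mul ?size_nseq ?zipmul1r //; lia.
Qed.

Lemma circ_at_tsplice n q M N L i j s1 s2 (w : C n) (c : C q) : size s1 = i ->
  (j < n)%N -> (i + n + size s2)%N = M -> (M + q)%N = N.+1 ->
  (n + q)%N = L.+1 ->
  circ_at N (i + j) (tsplice M s1 s2 w : C M) c =
  tsplice N s1 s2 (circ_at L j w c).
Proof.
move=> es jn eM eN eL; elim/tpow_ind: w => [d v w IHv IHw|t tn].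
  by rewrite linearP /= !circ_at_linl linearP /= IHv IHw.
have [t1 [v [t2 [et et1 et2]]]] := nth_split tn jn.
rewrite tsplice_tens // et -!catA cat_cons catA.
rewrite circ_at_tens ?size_cat ?et1 ?et2 ?es //; try lia.
rewrite circ_at_tens ?et2 //; try lia.
elim/tpow_ind: (_ * _) => [d x y IHx IHy|r rq].
  by rewrite !linearP /= IHx IHy.
by rewrite !tsplice_tens ?size_cat -?catA // ?et1 ?et2 ?rq; lia.
Qed.

Lemma circ_at_mul n q L j (v w : C n) (c : C q) : (j < n)%N ->
  (n + q)%N = L.+1 ->
  circ_at L j (v * w) c =
  (tslot L j (@iter_coproduct k g q) v : C L) * circ_at L j w c.
Proof.
by move=> jn eL; rewrite /circ_at tslot_mul // ?mulrA //; apply: rmorphM.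
Qed.

Definition prim_at N i (x : g) : C N :=
  tens N (nseq i 1 ++ iota x :: nseq (N - i.+1) 1).

Lemma tsplice_prim_at n N p q i x : (i < n)%N -> (p + n + q)%N = N ->
  tsplice N (nseq p 1) (nseq q 1) (prim_at n i x) = prim_at N (p + i) x.
Proof.
move=> lt <-; rewrite tsplice_tens ?size_cat /= ?size_nseq; last by lia.
rewrite -!catA cat_cons catA -!nseqD; congr (tens _ (_ ++ _ :: nseq _ _)).
by lia.
Qed.

(** Each step splits the first term, whose first factor is x, in two, and only
    puts another 1 in front of the others. *)
Lemma iter_coproduct_iota n x :
  iter_coproduct n (iota x) = \sum_(i < n) prim_at n i x.
Proof.
elim: n => [|[|n] IH].
- by rewrite big_ord0 /= counit_iota scale0r.
- by rewrite big_ord1.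
rewrite /= -/(iter_coproduct n.+1 _) IH linear_sum /= big_ord_recl.
rewrite !big_ord_recl addrA; congr (_ + _).
  rewrite tslot_tens_cat ?size_nseq //=; last by lia.
  rewrite /coproduct ulift_iota; last 2 first.
  - exact: primitive2_linear.
  - exact: primitive2_lie.
  rewrite /primitive2 linearD /= !tsplice_tens //.
  by rewrite /prim_at subn1 !subSS !subn0.
apply: eq_bigr => i _; have -> : prim_at n.+1 (lift ord0 i) x = tens n.+1 ([::]
    ++ 1 :: nseq i 1 ++ iota x :: nseq (n - i.+1) 1) by [].
have lt := ltn_ord i.
rewrite tslot_tens_cat //= ?size_cat /= ?size_nseq; last by lia.
by rewrite rmorph1 tsplice_tens.
Qed.

(** Coassociativity, in all its forms at once. Both sides are algebra morphisms
    on the enveloping algebra, so it is enough to compare them on the primitive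
    generators; q = 0 is counitality. *)
Lemma iter_coproductA n q L j (u : U) : (j < n)%N -> (n + q)%N = L.+1 ->
  tslot L j (@iter_coproduct k g q) (iter_coproduct n u) = iter_coproduct L u.
Proof.
move=> jn eL; elim/uea_ind: u => [||x|c u v IHu IHv|u v IHu IHv].
- by rewrite !linear0.
- by rewrite !rmorph1 tslot_one //; apply: rmorph1.
- have lt (i : 'I_n) := ltn_ord i.
  rewrite !iter_coproduct_iota linear_sum (sum_block ((prim_at L)^~ x) jn eL).
  rewrite (bigID (fun i : 'I_n => (i < j)%N)) /=; congr (_ + _).
    apply: eq_bigr => i ij; have := lt i => lti.
    have -> : prim_at n i x = tens n ((nseq i 1 ++ iota x :: nseq (j - i.+1) 1)
        ++ 1 :: nseq (n - j.+1) 1).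
      rewrite -catA cat_cons -[1 :: _]/(nseq (n - j.+1).+1 1) -nseqD.
      by congr (tens _ (_ ++ _ :: nseq _ _)); lia.
    rewrite tslot_tens_cat //= ?size_cat /= ?size_nseq; [|by lia..].
    rewrite rmorph1 tone_tens tsplice_tens ?size_nseq //.
    rewrite -catA cat_cons -!nseqD.
    by congr (tens _ (_ ++ _ :: nseq _ _)); lia.
  rewrite (bigD1 (Ordinal jn)) /= ?ltnn //; congr (_ + _).
    rewrite tslot_tens_cat ?size_nseq //=; last by lia.
    rewrite iter_coproduct_iota linear_sum; apply: eq_bigr => r _ /=.
    by rewrite tsplice_prim_at ?ltn_ord //; lia.
  apply: eq_big => [i|i /andP[ij ne]].
    by rewrite -leqNgt ltn_neqAle eq_sym andbC.
  have ji : (j < i)%N by rewrite ltn_neqAle eq_sym ne leqNgt.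
  have := lt i => lti.
  have -> : prim_at n i x = tens n (nseq j 1 ++
      1 :: nseq (i - j.+1) 1 ++ iota x :: nseq (n - i.+1) 1).
    rewrite -[1 :: _]/(nseq (i - j.+1).+1 1 ++ _) catA -nseqD.
    by congr (tens _ (nseq _ _ ++ _)); lia.
  rewrite tslot_tens_cat //= ?size_cat /= ?size_nseq; [|by lia..].
  rewrite rmorph1 tone_tens tsplice_tens ?size_nseq //.
  rewrite !catA -!nseqD.
  by congr (tens _ (nseq _ _ ++ _ :: nseq _ _)); lia.
- by rewrite !linearP /= IHu IHv.
by rewrite !rmorphM /= tslot_mul ?IHu ?IHv //; apply: rmorphM.
Qed.
(** The sequential axiom: c goes into one of the inputs of b. On the factor u of
    a which receives b, both sides spread u over all factors of b and c; they
    agree by multiplicativity and coassociativity of the coproduct. *)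
Lemma circ_at_seq m n q M N L i j (a : C m) (b : C n) (c : C q) :
  (i < m)%N -> (j < n)%N -> (m + n)%N = M.+1 -> (n + q)%N = L.+1 ->
  (M + q)%N = N.+1 ->
  circ_at N (i + j) (circ_at M i a b) c = circ_at N i a (circ_at L j b c).
Proof.
move=> im jn eM eL eN; elim/tpow_ind: a => [d u v IHu IHv|s sm].
  by rewrite !circ_at_linl IHu IHv.
have [s1 [u [s2 [-> s1i s2m]]]] := nth_split sm im.
rewrite !circ_at_tens ?s2m //; try lia.
rewrite (@circ_at_tsplice n _ _ _ L) ?s2m //; try lia.
by rewrite circ_at_mul // iter_coproductA.
Qed.

(** The parallel axiom: b and c go into different inputs of a. For a a pure
    tensor both sides are the tensor of the untouched factors with the two
    results w, w' of the insertions, which is bilinear in w and w'. *)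
Lemma circ_at_par m n q M M' N i j (a : C m) (b : C n) (c : C q) :
  (i < j)%N -> (j < m)%N -> (m + n)%N = M.+1 -> (m + q)%N = M'.+1 ->
  (M + q)%N = N.+1 ->
  circ_at N (j + n).-1 (circ_at M i a b) c =
  circ_at N i (circ_at M' j a c) b.
Proof.
move=> ij jm eM eM' eN; elim/tpow_ind: a => [d u v IHu IHv|s sm].
  by rewrite !circ_at_linl IHu IHv.
have [s1 [u [s' [-> s1i s'm]]]] := nth_split sm (ltn_trans ij jm).
have lt : (j - i.+1 < m - i.+1)%N by lia.
have [s2 [v [s3 [-> s2j s3m]]]] := nth_split s'm lt.
rewrite circ_at_tens ?size_cat /= ?s2j ?s3m //; try lia.
rewrite -cat_cons catA circ_at_tens ?size_cat /= ?s1i ?s2j ?s3m //; try lia.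
set w := _ * b; set w' := _ * c.
(* The tensor s1 (x) x (x) s2 (x) y (x) s3. *)
pose dbl (x : C n) (y : C q) : C N :=
  tlift (fun t => tsplice N (s1 ++ t ++ s2) s3 y) x.
have dbl_ml y : multilinear n (fun t => tsplice N (s1 ++ t ++ s2) s3 y : C N).
  move=> d t1 x y' t2 _; rewrite -!catA !cat_cons !(catA s1 t1).
  exact: tsplice_linl.
have dblr x d y y' : dbl x (d *: y + y') = d *: dbl x y + dbl x y'.
  rewrite /dbl -tlift_lin; apply: eq_tlift => t; exact: linearP.
transitivity (dbl w w').
  rewrite /w'; elim/tpow_ind: w => [d x y IHx IHy|t tn].
    by rewrite linearP circ_at_linl IHx IHy /dbl tlift_is_linear.
  rewrite /dbl tlift_tens // tsplice_tens // !catA.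
  by rewrite circ_at_tens ?size_cat ?s1i ?s2j ?s3m ?tn //; lia.
rewrite /w; elim/tpow_ind: w' => [d x y IHx IHy|t tn].
  by rewrite linearP circ_at_linl -IHx -IHy dblr.
rewrite tsplice_tens // -!catA cat_cons.
rewrite circ_at_tens ?size_cat ?s1i ?s2j ?s3m ?tn //; try lia.
elim/tpow_ind: (_ * b) => [d x y IHx IHy|r rn].
  by rewrite linearP /= -IHx -IHy /dbl tlift_is_linear.
by rewrite /dbl tlift_tens // !tsplice_tens // !catA.
Qed.

Local Notation mu := (1 : C 2).

Lemma circ_at_mu n N i (a : C n) : (i < n)%N -> N = n.+1 ->
  circ_at N i a mu = tslot N i (@coproduct k g) a.
Proof.
move=> lt ->; rewrite /circ_at tsplice_one; last by lia.
rewrite mulr1; apply: eq_tlift => s.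
by rewrite iter_coproduct2.
Qed.

Lemma mu_circ_at0 n N (a : C n) : N = n.+1 ->
  circ_at N 0 mu a = tsplice N [::] [:: 1] a.
Proof.
move=> ->; have -> : mu = tens 2 ([::] ++ 1 :: [:: 1]) by [].
by rewrite circ_at_tens //= rmorph1 mul1r.
Qed.

Lemma mu_circ_at1 n N (a : C n) : N = n.+1 ->
  circ_at N 1 mu a = tsplice N [:: 1] [::] a.
Proof.
move=> ->; have -> : mu = tens 2 ([:: 1] ++ 1 :: [::]) by [].
by rewrite circ_at_tens //= rmorph1 mul1r.
Qed.

(** The inner faces compose a with mu, the two outer ones compose mu with a. *)
Lemma differentialE n (a : C n) :
  differential a = circ_at n.+1 1 mu a
    + \sum_(i < n) (-1) ^+ i.+1 *: circ_at n.+1 i a mu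
    + (-1) ^+ n.+1 *: circ_at n.+1 0 mu a.
Proof.
rewrite /differential mu_circ_at0 // mu_circ_at1 //.
by congr (_ + _ + _); apply: eq_bigr => i _; rewrite circ_at_mu.
Qed.

(** The tensor product of a and b, see cup_tens, in the form in which it arises
    from the operad. *)
Definition cup m n N (a : C m) (b : C n) : C N :=
  circ_at N 0 (circ_at n.+1 1 mu b) a.

Lemma circ_linl m n N (b : C n) : linear (fun a : C m => circ N a b).
Proof.
move=> c a a'; rewrite /circ scaler_sumr -big_split; apply: eq_bigr => i _.
by rewrite circ_at_linl scalerDr /= !scalerA (mulrC c).
Qed.

Lemma circ_is_linear m n N (a : C m) : linear (@circ k g m n N a).
Proof.
move=> c a' b; rewrite /circ scaler_sumr -big_split; apply: eq_bigr => i _.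
by rewrite linearP scalerDr /= !scalerA (mulrC c).
Qed.
HB.instance Definition _ m n N (a : C m) := GRing.isLinear.Build k (C n) (C N)
  *:%R (@circ k g m n N a) (circ_is_linear N a).

End Operad.

(** * The bracket on cohomology *)

Section Gerstenhaber.
Variables (k : fieldType) (g : lieAlgType k).
Local Notation C := (cochain g).
Local Notation mu := (1 : C 2).

(** Makes linearity of circ_at in a available to the linear algebra lemmas. *)
Definition circ_at_right m n N i (b : C n) (a : C m) : C N := circ_at N i a b.
HB.instance Definition _ m n N i (b : C n) := GRing.isLinear.Build k (C m) (C N)
  *:%R (@circ_at_right m n N i b) (circ_at_linl N i b).

(** Gerstenhaber's formula. Most terms of the left hand side occur in da o b or
    a o db by the operad axioms. The terms of da o b that insert b into the
    additional factor 1 of an outer face of a, which is 1 (x) a or a (x) 1, are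
    the two cup products. *)
Lemma differential_circ m n N (a : C m) (b : C n) : (m + n)%N = N.+1 ->
  differential (circ N a b) = circ N.+1 (differential a) b
    + (-1) ^+ m.+1 *: circ N.+1 a (differential b)
    - (-1) ^+ (n.+1 * m) *: cup N.+1 b a + (-1) ^+ m *: cup N.+1 a b.
Proof.
move=> eN; rewrite differentialE.
have -> : circ_at N.+1 1 mu (circ N a b) = \sum_(i < m)
    (-1) ^+ (n.+1 * (m - i.+1)) *: circ_at N.+1 i.+1 (circ_at m.+1 1 mu a) b.
  rewrite /circ linear_sum; apply: eq_bigr => i _; rewrite linearZ /=.
  by rewrite -(@circ_at_seq _ _ 2 m n m.+1) ?ltn_ord //; lia.
have -> : circ_at N.+1 0 mu (circ N a b) = \sum_(i < m)
    (-1) ^+ (n.+1 * (m - i.+1)) *: circ_at N.+1 i (circ_at m.+1 0 mu a) b.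
  rewrite /circ linear_sum; apply: eq_bigr => i _; rewrite linearZ /=.
  by rewrite -(@circ_at_seq _ _ 2 m n m.+1) ?ltn_ord //; lia.
have -> : \sum_(j < N) (-1) ^+ j.+1 *: circ_at N.+1 j (circ N a b) mu =
    \sum_(i < m) (-1) ^+ (n.+1 * (m - i.+1)) *:
      \sum_(j < N) (-1) ^+ j.+1 *: circ_at N.+1 j (circ_at N i a b) mu.
  under [RHS]eq_bigr => i _ do rewrite scaler_sumr.
  rewrite exchange_big; apply: eq_bigr => j _ /=.
  rewrite -[circ_at _ _ _ mu]/(circ_at_right N.+1 j mu _) /circ linear_sum.
  rewrite scaler_sumr; apply: eq_bigr => i _.
  by rewrite linearZ /= !scalerA mulrC.
rewrite (@circ_sum_identity _ _ m n N
  (fun i => circ_at N.+1 i (circ_at m.+1 1 mu a) b)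
  (fun i => circ_at N.+1 i (circ_at m.+1 0 mu a) b)
  (fun i => circ_at N.+1 i a (circ_at n.+1 0 mu b))
  (fun i => circ_at N.+1 i a (circ_at n.+1 1 mu b))
  (fun p q => circ_at N.+1 q (circ_at m.+1 p a mu) b)
  (fun i j => circ_at N.+1 j (circ_at N i a b) mu)
  (fun i r => circ_at N.+1 i a (circ_at n.+1 r b mu))) //; first last.
- move=> p pm; rewrite -(@circ_at_seq _ _ m 2 n m.+1); [|lia..].
  by rewrite addn1.
- move=> p pm; rewrite -(@circ_at_seq _ _ m 2 n m.+1); [|lia..].
  by rewrite addn0.
- by move=> i p ip pm; rewrite (@circ_at_par _ _ m n 2 N m.+1) //; lia.
- by move=> i r im rn; rewrite -(@circ_at_seq _ _ m n 2 N) //; lia.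
- move=> i p pi im; rewrite -(@circ_at_par _ _ m 2 n m.+1 N); try lia.
  by rewrite addn2.
rewrite /cup (@circ_at_par _ _ 2 m n m.+1 n.+1 N.+1 0 1) //; last by lia.
congr (_ + _ *: _ - _ + _).
- apply: eq_bigr => q _; congr (_ *: _); rewrite differentialE.
  rewrite -[RHS]/(circ_at_right N.+1 q b _) !linearD linearZ linear_sum.
  by congr (_ + _ + _); apply: eq_bigr => p _; rewrite linearZ.
- apply: eq_bigr => q _; congr (_ *: _); rewrite differentialE.
  rewrite !linearD linearZ linear_sum.
  by congr (_ + _ + _); apply: eq_bigr => p _; rewrite linearZ.
Qed.
(** The bracket with values in an arbitrary degree N: antisymmetry and induction
    on the arguments would otherwise need casts between (m + n).-1 and its
    variants. *)
Definition gbracket m n N (a : C m) (b : C n) : C N :=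
  circ N a b - (-1) ^+ (n.+1 * m.+1) *: circ N b a.

Lemma bracketE m n (a : C m) (b : C n) : bracket a b = gbracket _ a b.
Proof. by []. Qed.

Lemma gbracketC m n N (a : C m) (b : C n) :
  gbracket N b a = - (-1) ^+ (n.+1 * m.+1) *: gbracket N a b.
Proof.
rewrite /gbracket scaleNr scalerBr opprB scalerA (mulnC m.+1).
by rewrite -expr2 sqrr_sign scale1r.
Qed.

Lemma gbracket_is_linear m n N (a : C m) : linear (@gbracket m n N a).
Proof.
move=> c b b'; rewrite /gbracket linearP circ_linl scalerBr scalerDr !scalerA.
by rewrite opprD addrACA mulrC.
Qed.
HB.instance Definition _ m n N (a : C m) := GRing.isLinear.Build k (C n) (C N)
  *:%R (@gbracket m n N a) (gbracket_is_linear N a).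

Lemma gbracket_linl m n N (b : C n) : linear (fun a : C m => gbracket N a b).
Proof.
by move=> c a a'; rewrite !(gbracketC _ b) linearP /= scalerDr !scalerA mulrC.
Qed.

(** The cup products in the differentials of the two circle products cancel. *)
Lemma differential_gbracket m n N (a : C m) (b : C n) : (m + n)%N = N.+1 ->
  differential (gbracket N a b) = gbracket N.+1 (differential a) b
    + (-1) ^+ m.+1 *: gbracket N.+1 a (differential b).
Proof.
move=> eN; rewrite /gbracket linearB linearZ /= !differential_circ //;
  last by lia.
rewrite !scalerDr !scalerN !scalerA -!exprD !opprD !opprK.
rewrite [LHS](AC (4*4) ((1*6)*(2*5)*((3*8)*(4*7)))) /=.
rewrite -!scaleNr -!scalerDl.
have -> : - (-1) ^+ (n.+1 * m) - (-1) ^+ (n.+1 * m.+1 + n) = 0 :> k.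
  by rewrite -opprD; apply/eqP; rewrite oppr_eq0; apply/eqP; parity.
have -> : (-1) ^+ m + (-1) ^+ (n.+1 * m.+1 + m.+1 * n) = 0 :> k by parity.
rewrite !scale0r !addr0; congr (_ + _ *: _ + (_ + _ *: _)); congr (- _); parity.
Qed.

Lemma differential0 (a : C 0) : differential a = 0.
Proof.
rewrite /differential big_ord0 addr0 expr1 scaleN1r.
elim/tpow_ind: a => [c u v IHu IHv|[|//] _].
  by rewrite !linearP /= addrACA -scalerDr IHu IHv scaler0 addr0.
by rewrite !tsplice_tens ?subrr.
Qed.

Lemma coboundaryB n (a b : C n) :
  coboundary a -> coboundary b -> coboundary (a - b).
Proof.
by move=> ha hb; have := coboundary_lin (-1) hb ha; rewrite scaleN1r addrC.
Qed.

Lemma coboundaryD n (a b : C n) :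
  coboundary a -> coboundary b -> coboundary (a + b).
Proof. by move=> ha hb; have := coboundary_lin 1 ha hb; rewrite scale1r. Qed.

Lemma coboundaryZ n c (a : C n) : coboundary a -> coboundary (c *: a).
Proof.
by move=> ha; have := coboundary_lin c ha (@coboundary0 _ _ n); rewrite addr0.
Qed.

Lemma gbracket_cocycle m n N (a : C m) (b : C n) : N = (m + n).-1 ->
  cocycle a -> cocycle b -> cocycle (gbracket N a b).
Proof.
case: N => [|N] eN /eqP za /eqP zb; apply/eqP; first exact: differential0.
rewrite differential_gbracket ?za ?zb; last by lia.
by rewrite linear0 gbracketC linear0 !scaler0 addr0.
Qed.

Lemma gbracket_coboundary m n N (a : C m) (b : C n) : N = (m + n).-1 ->
  cocycle a -> coboundary b -> coboundary (gbracket N a b).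
Proof.
case: n b => [b _ _ -> | n b eN /eqP za [c ->]].
  by rewrite linear0; apply: coboundary0.
have {}eN : N = (m + n)%N by lia.
case: N eN => [|N] eN.
  (* In total degree 0 nothing lies below, but then b is the differential of a
     scalar, hence 0. *)
  have n0 : n = 0%N by lia.
  by subst n; rewrite differential0 linear0.
exists ((-1) ^+ m.+1 *: gbracket N a c).
rewrite linearZ /= differential_gbracket // za (gbracketC _ c 0) linear0.
by rewrite scaler0 add0r scalerA -expr2 sqrr_sign scale1r.
Qed.

(** The representatives chosen by hbracket differ from the given ones by
    coboundaries, on which gbracket_coboundary applies in either argument. *)
Lemma hbracket_hclass m n (a : C m) (b : C n) : cocycle a -> cocycle b ->
  hbracket (hclass a) (hclass b) = hclass (bracket a b).
Proof.
move=> za zb; rewrite /hbracket.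
have rep p (x : C p) : cocycle x ->
    cocycle (val (repr (hclass x))) /\ coboundary (val (repr (hclass x)) - x).
  move=> zx; split; first exact: (valP (repr (hclass x))).
  by have := hrepr (insubd (0 : cocycles g p) x); rewrite insubdK.
have [za' ha] := rep _ _ za; have [zb' hb] := rep _ _ zb.
set a' : C m := val (repr (hclass a)) in za' ha *.
set b' : C n := val (repr (hclass b)) in zb' hb *.
rewrite !bracketE.
apply/hclassE; [exact: gbracket_cocycle..|].
have -> : gbracket (m + n).-1 a' b' - gbracket (m + n).-1 a b =
    gbracket (m + n).-1 a' (b' - b) + gbracket (m + n).-1 (a' - a) b.
  rewrite (linearB (gbracket (m + n).-1 a')) -[a' - a]addrC -scaleN1r.
  by rewrite gbracket_linl scaleN1r addrA addrAC subrK addrC.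
apply: coboundaryD; first exact: gbracket_coboundary.
rewrite (gbracketC _ b (a' - a)); apply: coboundaryZ.
by apply: gbracket_coboundary => //; rewrite addnC.
Qed.
End Gerstenhaber.

(** * The bracket of tensors of Lie algebra elements *)

Section PureTensors.
Variables (k : fieldType) (g : lieAlgType k).
Local Notation U := (uea g).
Local Notation C := (cochain g).
Local Notation iota := (@Defs.iota k g).
Local Notation T n x := (tens n (map iota x) : C n).
Implicit Types (l r s t : seq U) (x y : seq g).

Lemma differential_cons n u s : size s = n ->
  differential (tens n.+1 (u :: s) : C n.+1) =
  - tsplice n.+2 [::] s (red_coproduct u)
  - tsplice n.+2 [:: u] [::] (differential (tens n s : C n)).
Proof.
move=> sn; rewrite !differential_tens //= ?sn // big_ord_recl /= drop0 expr1.
rewrite scaleN1r; congr (_ + _); rewrite linear_sum -sumrN /=.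
apply: eq_bigr => i _; have lt := ltn_ord i; rewrite linearZ /=.
rewrite tsplice_tsplice ?cats0; last by rewrite size_takel ?size_drop sn; lia.
by rewrite exprS mulN1r scaleNr.
Qed.

(** Tensoring with a primitive element anticommutes with the differential, while
    a product of two of them (differential_prim2) also contributes its reduced
    coproduct. *)
Lemma differential_prim n z (a : C n) :
  differential (tsplice n.+1 [:: iota z] [::] a : C n.+1) =
  - tsplice n.+2 [:: iota z] [::] (differential a).
Proof.
elim/tpow_ind: a => [c u v IHu IHv|s sn].
  by rewrite !linearP /= IHu IHv.
rewrite tsplice_tens //= cats0 differential_cons // red_coproduct_iota.
by rewrite linear0 oppr0 add0r.
Qed.

Lemma differential_prim2 n w z (a : C n) :
  differential (tsplice n.+1 [:: iota w * iota z] [::] a : C n.+1) =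
  - (tsplice n.+2 [:: iota w; iota z] [::] a
     + tsplice n.+2 [:: iota z; iota w] [::] a)
  - tsplice n.+2 [:: iota w * iota z] [::] (differential a).
Proof.
elim/tpow_ind: a => [c u v IHu IHv|s sn].
  rewrite !linearP /= IHu IHv.
  rewrite [X in _ = - X + _]addrACA -[X in _ = - (X + _) + _]scalerDr
    [X in _ = X + _]opprD -scalerN.
  by rewrite [RHS]addrACA -[X in _ = X + _]scalerDr.
rewrite tsplice_tens //= cats0 differential_cons // red_coproduct_mul.
by rewrite linearD /= !tsplice_tens //= !cats0.
Qed.

Lemma coboundary_prim N z (a : C N.-1) : coboundary a ->
  coboundary (tsplice N [:: iota z] [::] a : C N).
Proof.
case: N a => [|[|N]] a /=; first by move->; rewrite linear0.
  by move->; exists 0; rewrite !linear0.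
move=> [c ->]; exists (- tsplice N.+1 [:: iota z] [::] c).
by rewrite linearN /= differential_prim opprK.
Qed.

(** Insertions into the first factor u, and into the other factors. *)
Lemma circ_cons m n N u s (b : C n) : size s = m -> N = (m + n)%N ->
  circ N (tens m.+1 (u :: s) : C m.+1) b =
  (-1) ^+ (n.+1 * m) *: tsplice N [::] s (iter_coproduct n u * b)
  + tsplice N [:: u] [::] (circ N.-1 (tens m s : C m) b).
Proof.
move=> sm eN; rewrite /circ big_ord_recl /= subn1 /=; congr (_ *: _ + _).
  by rewrite (@circ_at_tens _ _ m.+1 n N 0 [::] u s b) ?sm ?eN.
rewrite linear_sum; apply: eq_bigr => i _; have lt := ltn_ord i.
rewrite linearZ /= subSS; congr (_ *: _).
have -> : tens m.+1 (u :: s) = tsplice m.+1 [:: u] [::] (tens m s : C m).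
  by rewrite tsplice_tens //= cats0.
by rewrite -(@circ_at_tsplice _ _ m n m.+1 N N.-1 1 i) //=; lia.
Qed.

Lemma cup_tens m n N s t : size s = m -> size t = n -> N = (m + n)%N ->
  cup N (tens m s : C m) (tens n t : C n) = tens N (s ++ t).
Proof.
move=> sm tn ->; rewrite /cup mu_circ_at1 // tsplice_tens //= cats0.
rewrite (@circ_at_tens _ _ n.+1 m _ 0 [::] 1 t) //; [|by rewrite tn|by lia].
by rewrite rmorph1 mul1r tsplice_tens.
Qed.

Lemma iter_coproduct_cons n z w (s : seq U) : size s = n ->
  iter_coproduct n.+1 (iota z) * (tens n.+1 (w :: s) : C n.+1) =
  tens n.+1 (iota z * w :: s)
  + tsplice n.+1 [:: w] [::] (iter_coproduct n (iota z) * (tens n s : C n)).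
Proof.
move=> sn; rewrite !iter_coproduct_iota big_ord_recl mulrDl; congr (_ + _).
  rewrite /prim_at /= cochain_mul_tens //= ?size_nseq ?sn ?subn1 //=.
  by rewrite zipmul_cons -sn zipmul1l.
rewrite !mulr_suml linear_sum; apply: eq_bigr => i _; have lt := ltn_ord i.
have si : size (nseq i 1 ++ iota z :: nseq (n - i.+1) 1) = n.
  by rewrite size_cat /= !size_nseq; lia.
rewrite /prim_at /= [LHS]cochain_mul_tens /= ?sn ?si //; last first.
rewrite cochain_mul_tens // tsplice_tens ?size_zipmul ?si ?sn //= cats0.
by rewrite zipmul_cons mul1r.
Qed.

Lemma circ0n m n N (b : C n) (a : C m) : m = 0%N -> circ N a b = 0.
Proof. by move=> m0; subst m; rewrite /circ big_ord0. Qed.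

(** The differential of the homotopy in circ_cons_coboundary: the first two
    terms come from the reduced coproduct of the product of w and z, the last
    two from differential_circ, as tensors of elements of g are cocycles. *)
Lemma differential_prim2_circ w z m n x y : size x = m -> size y = n ->
  let D := circ (n + m).-1 (T n y) (T m x) in
  differential (tsplice (n + m) [:: iota w * iota z] [::] D : C (n + m)) =
  - (tsplice (n + m).+1 [:: iota w; iota z] [::] D
     + tsplice (n + m).+1 [:: iota z; iota w] [::] D)
  - ((-1) ^+ n *:
       tens (n + m).+1 (iota w * iota z :: map iota y ++ map iota x)
     - (-1) ^+ (m.+1 * n) *:
       tens (n + m).+1 (iota w * iota z :: map iota x ++ map iota y)).
Proof.
move=> <- <- D; case: y @D => [|v y] D.
  by rewrite {}/D circ0n // !linear0 !addr0 oppr0 muln0 cats0 subrr subr0.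
rewrite [LHS](@differential_prim2 (size y + size x)%N); congr (_ - _).
rewrite [differential _](@differential_circ _ _ _ _ (size y + size x)%N) //.
have /eqP -> := iota_cocycle (erefl (size (v :: y))).
have /eqP -> := iota_cocycle (erefl (size x)).
rewrite linear0 scaler0 addr0 [circ _ 0 _]big1 => [|i _]; last first.
  by rewrite -[circ_at _ _ _ _]/(circ_at_right _ i _ _) linear0 scaler0.
rewrite !cup_tens ?size_map //=; last by lia.
rewrite add0r addrC linearB !linearZ /= !tsplice_tens ?size_cat ?size_map //=.
- by rewrite !cats0.
- by rewrite size_map; lia.
by rewrite size_cat !size_map.
Qed.

(** The counterpart of circ_cons for the second argument. By induction on y the
    claim for w :: y reduces to the differential of the tensor product of
    iota w * iota z with the circle product of y and x. *)
Lemma circ_cons_coboundary m n N z x y : size x = m -> size y = n ->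
  N = (n + m)%N ->
  coboundary (circ N (T n y) (T m.+1 (z :: x))
    - (tsplice N [::] (map iota x) (circ n (T n y) (T 1 [:: z]))
       + (-1) ^+ n.+1 *:
           tsplice N [:: iota z] [::] (circ N.-1 (T n y) (T m x)))).
Proof.
move=> xm; elim: y n N => [|w y IH] n N <- eN.
  rewrite /circ !big_ord0 !linear0 /= addr0 subr0; exact: coboundary0.
rewrite /= in eN *; set p := size y in eN *.
subst N; have {IH} := IH p (p + m)%N erefl erefl.
set X := map iota x; set Y := map iota y.
set D := circ (p + m).-1 (tens p Y : C p) (tens m X : C m).
have sX : size X = m by rewrite size_map.
have sY : size Y = p by rewrite size_map.
move=> /(@coboundary_prim (p + m).+1 w) hIH.
rewrite !circ_cons ?sY //; try lia.
rewrite -[(p.+1 + m).-1]/(p + m)%N -[(p.+1 + m)%N]/(p + m).+1 -[p.+1.-1]/p.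
rewrite iter_coproduct_cons ?sX //= -/X -/D in hIH *.
rewrite cochain_mul_tens //= zipmul_cons.
pose P (u v : U) := tsplice (p + m).+1 [:: u; v] [::] D.
have DE u v :
    tsplice (p + m).+1 [:: u] [::] (tsplice (p + m) [:: v] [::] D) = P u v.
  (* For p = 0 the degree (p + m).-1 of D may be truncated, but then D = 0. *)
  have [p0|pp] := posnP p; last by rewrite tsplice_tsplice //=; lia.
  by rewrite /P /D circ0n // !linear0.
have dH : differential (tsplice (p + m) [:: iota w * iota z] [::] D : C (p + m))
    = - (P (iota w) (iota z) + P (iota z) (iota w))
      - ((-1) ^+ p *: tens (p + m).+1 (iota w * iota z :: Y ++ X)
         - (-1) ^+ (m.+1 * p) *: tens (p + m).+1 (iota w * iota z :: X ++ Y)).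
  exact: differential_prim2_circ.
rewrite linearB linearD linearZ /= DE !tsplice_tsplice ?sX ?cats0 //= in hIH.
rewrite !linearD !linearZ /= DE !tsplice_tsplice /= ?cats0 ?sX ?sY //; try lia.
rewrite !tsplice_tens ?sX //=.
have ddH : coboundary ((-1) ^+ p *: differential
    (tsplice (p + m) [:: iota w * iota z] [::] D : C (p + m))).
  by apply: coboundaryZ; eexists.
have := @coboundaryD _ _ (p + m).+1 _ _ hIH ddH.
congr (coboundary _); rewrite {}dH.
rewrite !scalerN /=.
set s := (-1) ^+ p; set t := (-1) ^+ (m.+1 * p).
have -> : (-1) ^+ (m.+2 * p) = s * t by rewrite -exprD; parity.
have -> : (-1) ^+ (2 * p) = 1 :> k by rewrite exprM sqrrN !expr1n.
have -> : (-1) ^+ p.+2 = s by rewrite /s; parity.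
have -> : (-1) ^+ p.+1 = - s by rewrite exprS mulN1r.
have ss : s * s = 1 by rewrite -expr2 sqrr_sign.

move: (tsplice _ [:: iota w] [::] _) (tsplice _ [:: iota w] X _) => W W'.
move: (P _ _) (P _ _) (tsplice _ [:: iota z] Y _) => P1 P2 q.
move: (tens _ (_ :: Y ++ X)) (tens _ (_ :: X ++ Y)) => b a.
rewrite !scaleNr !opprD !opprK !scalerDr !scalerN !scalerA ss !scale1r.
rewrite [LHS](AC ((1*2)*(2*2)) ((3*4)*(7*1*6*2*5))) /=.
rewrite [RHS](AC (3*(2*2)) (2*6*(1*3*4*5*7))) /=.
  by rewrite !subrr.
by rewrite sX.
Qed.

(** The two ways to insert z : g and the y_j into each other, compared:
    the products z y_j and y_j z in U(g) differ by a Lie bracket. *)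
Lemma iter_coproduct_sub_circ n z y : size y = n ->
  iter_coproduct n (iota z) * T n y - circ n (T n y) (T 1 [:: z]) =
  \sum_(j < n) T n (take j y ++ lie z (nth 0 y j) :: drop j.+1 y).
Proof.
move=> <-; elim: y => [|w y IH].
  by rewrite big_ord0 circ0n // iter_coproduct_iota big_ord0 mul0r subr0.
rewrite [size _]/= [map _ _]/= iter_coproduct_cons ?size_map //.
rewrite circ_cons ?size_map ?addn1 // exprM sqrrN !expr1n scale1r.
rewrite big_ord_recl /= drop0 cochain_mul_tens //= tsplice_tens //=.
rewrite opprD addrACA -linearB IH; congr (_ + _); last first.
  rewrite linear_sum; apply: eq_bigr => j _; have lt := ltn_ord j.
  rewrite /= tsplice_tens ?cats0 // size_map size_cat size_takel ?(ltnW lt) //=.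
  by rewrite size_drop; lia.
have := @tens_lin _ U (size y).+1 (-1) [::] (iota w * iota z) (iota z * iota w)
  (map iota y).
by rewrite !scaleN1r /= [- (_ * _) + _]addrC -iota_lie => ->; rewrite addrC.
Qed.

Lemma gbracket_nil n N y : size y = n -> N = n.-1 ->
  gbracket N (T 0 [::]) (T n y) = 0.
Proof.
move=> yn eN; rewrite /gbracket circ0n // sub0r.
suff -> : circ N (T n y) (T 0 [::]) = 0 by rewrite scaler0 oppr0.
elim: y n N yn eN => [|w y IH] n N <- eN; first by rewrite circ0n.
rewrite /= in eN; subst N; rewrite circ_cons ?size_map ?addn0 //.
by rewrite iter_coproduct_iota big_ord0 mul0r IH // !linear0 add0r.
Qed.

Definition bracket_seq x y i j : seq g :=
  take i x ++ take j y ++ lie (nth 0 x i) (nth 0 y j) ::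
    drop j.+1 y ++ drop i.+1 x.

(** By circ_cons and circ_cons_coboundary, splitting off the first entry z of x
    reduces the bracket with x to the one with the remaining entries and to the
    difference computed in iter_coproduct_sub_circ. *)
Lemma gbracket_tens m n N x y : size x = m -> size y = n -> N = (m + n).-1 ->
  coboundary (gbracket N (T m x) (T n y) - \sum_(i < m)
    (-1) ^+ (n.+1 * (m - i.+1)) *: (\sum_(j < n) T N (bracket_seq x y i j))).
Proof.
elim: x m N => [|z x IH] m N <- yn eN.
  rewrite gbracket_nil // big_ord0 subr0; exact: coboundary0.
rewrite /= in eN *; subst N.
set m' := size x in IH *; have {IH} := IH m' (m' + n).-1 erefl yn erefl.
move=> /(@coboundary_prim (m' + n) z); rewrite linearB /= => h1.
have h2 := @circ_cons_coboundary m' n (m' + n) z x y erefl yn (addnC _ _).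
have {h1 h2} := coboundaryB h1 (coboundaryZ ((-1) ^+ (n.+1 * m')) h2).
congr (coboundary _).
rewrite /gbracket circ_cons ?size_map //=.
rewrite big_ord_recl subn1 /=.
have -> : \sum_(j < n) T (m' + n) (bracket_seq (z :: x) y 0 j) =
    tsplice (m' + n) [::] (map iota x) (iter_coproduct n (iota z) * T n y)
    - tsplice (m' + n) [::] (map iota x) (circ n (T n y) (T 1 [:: z])).
  rewrite -linearB iter_coproduct_sub_circ // linear_sum; apply: eq_bigr => j _.
  rewrite /bracket_seq /= drop0 tsplice_tens /= -?map_cat -?catA //.
  have lt := ltn_ord j; rewrite size_map size_cat /= size_drop.
  by rewrite size_takel ?yn; lia.
have -> : \sum_(i < m') (-1) ^+ (n.+1 * (m'.+1 - (bump 0 i).+1)) *: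
      (\sum_(j < n) T (m' + n) (bracket_seq (z :: x) y (bump 0 i) j)) =
    tsplice (m' + n) [:: iota z] [::] (\sum_(i < m')
      (-1) ^+ (n.+1 * (m' - i.+1)) *:
        (\sum_(j < n) T (m' + n).-1 (bracket_seq x y i j))).
  rewrite linear_sum; apply: eq_bigr => i _; have lti := ltn_ord i.
  rewrite [RHS]linearZ /= subSS; congr (_ *: _).
  rewrite [RHS]linear_sum; apply: eq_bigr => j _ /=.
  rewrite tsplice_tens ?cats0 //= size_map /bracket_seq !size_cat /= size_cat.
  have ltj := ltn_ord j.
  by rewrite !size_drop !size_takel ?yn -/m'; lia.
rewrite linearB linearZ /=.
have -> : (-1) ^+ (n.+1 * m'.+2) = (-1) ^+ (n.+1 * m') :> k by parity.
have -> : (-1) ^+ (n.+1 * m'.+1) = (-1) ^+ (n.+1 * m') * (-1) ^+ n.+1 :> k.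
  by rewrite -exprD; parity.
rewrite !scalerBr !scalerDr !scalerA !opprD !opprK.
rewrite [LHS](AC (3*(1*2)) ((2*6)*(1*4*5*3))) /=.
rewrite [RHS](AC (3*3) ((1*4)*(2*3*5*6))) /=.
by rewrite addNr subrr.
Qed.

End PureTensors.

(** * Comparison with the Schouten bracket *)

Section Reordering.
Variables (k : fieldType) (g : lieAlgType k).

Lemma wedge_swap_blocks N (a s t b : seq g) :
  (size a + size s + size t + size b)%N = N ->
  wedge N (a ++ s ++ t ++ b) =
  (-1) ^+ (size s * size t) *: wedge N (a ++ t ++ s ++ b).
Proof.
elim: t a => [|z t IH] a eN; first by rewrite muln0 scale1r.
have swap := swap_move (alternating_swap (@wedge_alternating k g N)).
rewrite /= swap; last by rewrite size_cat -eN /=; lia.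
rewrite -cat_rcons IH; last by rewrite size_rcons -eN /=; lia.
by rewrite scalerA -exprD -mulnS cat_rcons.
Qed.

(** The bracket passes i + j vectors on its way to the front, and m - i - 1
    vectors of x pass the n - 1 remaining vectors of y; the second sign is the
    one of gbracket_tens. *)
Lemma wedge_bracket_seq m n N (x y : seq g) i j :
  size x = m -> size y = n -> N = (m + n).-1 -> (i < m)%N -> (j < n)%N ->
  (-1) ^+ (n.+1 * (m - i.+1)) *: wedge N (bracket_seq x y i j) =
  (-1) ^+ (i + j) *: wedge N (lie (nth 0 x i) (nth 0 y j) ::
    take i x ++ drop i.+1 x ++ take j y ++ drop j.+1 y).
Proof.
move=> xm yn -> im jn; rewrite /bracket_seq.
have swap := swap_move (alternating_swap (@wedge_alternating k g (m + n).-1)).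
set z := lie _ _.
have szi : size (take i x) = i by rewrite size_takel // xm ltnW.
have szj : size (take j y) = j by rewrite size_takel // yn ltnW.
rewrite catA (swap [::]) ?size_cat ?szi ?szj ?size_drop ?xm ?yn /=; last by lia.
have := @wedge_swap_blocks (m + n).-1 (z :: take i x) (take j y ++ drop j.+1 y)
  (drop i.+1 x) [::].
rewrite !cats0 /= size_cat szi szj !size_drop xm yn -!catA => ->; last by lia.
rewrite !scalerA -!exprD; congr (_ *: _).
have [d e] : exists d, (n = d.+1)%N by exists n.-1; lia.
have -> : (j + (n - j.+1))%N = d by lia.
rewrite e; parity.
Qed.
End Reordering.

Section MainTheorem.
Variables (k : fieldType) (g : lieAlgType k).
Hypothesis k0 : [pchar k] =i pred0.
Local Notation C := (cochain g).
Local Notation iota := (@Defs.iota k g).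
Local Notation T n x := (tens n (map iota x) : C n).

Lemma hclass_sum n (I : Type) (r : seq I) (c : I -> k) (F : I -> C n) :
  (forall i, cocycle (F i)) ->
  cocycle (\sum_(i <- r) c i *: F i) /\
  hclass (\sum_(i <- r) c i *: F i) = \sum_(i <- r) c i *: hclass (F i).
Proof.
move=> zF; elim: r => [|i r [zr IH]].
  rewrite !big_nil; have z0 : cocycle (0 : C n) by apply/eqP; rewrite linear0.
  by have := hclass_lin (-1) z0 z0; rewrite scaler0 addr0 scaleN1r addNr.
rewrite !big_cons hclass_lin // IH; split=> //.
by have [_ h] := @cocycle_submod k g n; exact: h (zF i) zr.
Qed.

Lemma hbracket_linl m n (v : cohomology g n) :
  linear (fun u : cohomology g m => hbracket u v).
Proof.
move=> c u u'; have [b zb ->] := hclass_surj v.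
have [a za ->] := hclass_surj u; have [a' za' ->] := hclass_surj u'.
rewrite -hclass_lin // !hbracket_hclass //; last first.
  by have [_ h] := @cocycle_submod k g m; exact: h za za'.
rewrite !bracketE gbracket_linl hclass_lin //; exact: gbracket_cocycle.
Qed.

Lemma hbracket_linr m n (u : cohomology g m) :
  linear (fun v : cohomology g n => hbracket u v).
Proof.
move=> c v v'; have [a za ->] := hclass_surj u.
have [b zb ->] := hclass_surj v; have [b' zb' ->] := hclass_surj v'.
rewrite -hclass_lin // !hbracket_hclass //; last first.
  by have [_ h] := @cocycle_submod k g n; exact: h zb zb'.
rewrite !bracketE linearP hclass_lin //; exact: gbracket_cocycle.
Qed.

Lemma hbracket_wedge m n (x y : seq g) : size x = m -> size y = n ->
  hbracket (ext_cohomology (wedge m x)) (ext_cohomology (wedge n y)) =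
  ext_cohomology (schouten (wedge m x) (wedge n y)).
Proof.
move=> xm yn; rewrite !ext_cohomology_wedge // schouten_wedge //.
have zx := iota_cocycle xm; have zy := iota_cocycle yn.
rewrite hbracket_hclass // bracketE.
set N := (m + n).-1.
pose sgn i := (-1) ^+ (n.+1 * (m - i.+1)) : k.
have zT (i : 'I_m) (j : 'I_n) : size (bracket_seq x y i j) = N.
  have [lti ltj] := (ltn_ord i, ltn_ord j).
  rewrite /bracket_seq !size_cat /= size_cat !size_drop !size_takel ?xm ?yn;
    rewrite /N; lia.
have inner (i : 'I_m) := hclass_sum (index_enum 'I_n) (fun=> 1)
  (fun j => iota_cocycle (zT i j)).
have [zS hS] := hclass_sum (index_enum 'I_m) (fun i => sgn i)
  (fun i => proj1 (inner i)).
have -> : hclass (gbracket N (T m x) (T n y)) = hclass (\sum_(i < m) sgn i *: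
    \sum_(j < n) 1 *: T N (bracket_seq x y i j)).
  apply/hclassE => //; first exact: gbracket_cocycle.
  under eq_bigr => i _ do under eq_bigr => j _ do rewrite scale1r.
  exact: gbracket_tens.
rewrite hS.
have lin := @ext_cohomology_is_linear k g k0 N.
pose E : {linear ext g N -> cohomology g N} :=
  HB.pack (@ext_cohomology k g N) (GRing.isLinear.Build _ _ _ _ _ lin).
rewrite -[ext_cohomology _]/(E _) linear_sum; apply: eq_bigr => i _.
rewrite (proj2 (inner i)) scaler_sumr linear_sum; apply: eq_bigr => j _.
rewrite scale1r -ext_cohomology_wedge // -[ext_cohomology _]/(E _) -linearZ /=.
by rewrite wedge_bracket_seq.
Qed.

Lemma hbracket_ext_cohomology m n (u : ext g m) (v : ext g n) :
  hbracket (ext_cohomology u) (ext_cohomology v) =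
  ext_cohomology (schouten u v).
Proof.
have linE p := @ext_cohomology_is_linear k g k0 p.
have lin0 (V W : lmodType k) (f : V -> W) : linear f -> f 0 = 0.
  by move=> lf; have := lf (-1) 0 0; rewrite scaler0 addr0 scaleN1r addNr.
elim/ext_ind: u => [|c u u' IH IH'|x xm].
- rewrite (lin0 _ _ _ (linE m)) (lin0 _ _ _ (hbracket_linl _)).
  by rewrite (lin0 _ _ _ (schouten_linl v)) (lin0 _ _ _ (linE _)).
- by rewrite schouten_linl !linE hbracket_linl IH IH'.
elim/ext_ind: v => [|c v v' IH IH'|y yn].
- rewrite (lin0 _ _ _ (linE n)) (lin0 _ _ _ (hbracket_linr _)).
  by rewrite (lin0 _ _ _ (schouten_linr _)) (lin0 _ _ _ (linE _)).
- by rewrite schouten_linr !linE hbracket_linr IH IH'.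
exact: hbracket_wedge.
Qed.
End MainTheorem.

Theorem proposition4p9 (k : fieldType) (k0 : [pchar k] =i pred0)
    (g : lieAlgType k) :
  (forall (m n : nat) (a : cochain g m) (b : cochain g n),
     cocycle a -> cocycle b ->
     cocycle (bracket a b) /\
     hbracket (hclass a) (hclass b) = hclass (bracket a b)) /\
  (forall (s t : nat) (u : ext g s) (v : ext g t),
     hbracket (ext_cohomology u) (ext_cohomology v) =
     ext_cohomology (schouten u v)) /\
  (forall (s t : nat) (x : s.-tuple g) (y : t.-tuple g),
     schouten (wedge s x) (wedge t y) =
     \sum_(i < s) \sum_(j < t) (-1) ^+ (i + j) *:
       wedge (s + t).-1 (lie (tnth x i) (tnth y j) ::
         take i x ++ drop i.+1 x ++ take j y ++ drop j.+1 y)).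
Proof.
split=> [m n a b za zb|].
  by split; [exact: gbracket_cocycle|exact: hbracket_hclass].
split=> [s t u v|s t x y]; first exact: hbracket_ext_cohomology.
rewrite schouten_wedge ?size_tuple //; apply: eq_bigr => i _.
by apply: eq_bigr => j _; rewrite /schouten_term !(tnth_nth 0).
Qed.
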